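(* Let $Z$ be a $JB^*$-triple system. (a) There exist, uniquely up to $*$-isomorphism, a $C^*$-algebra $C^*(Z)$ and a $JB^*$-triple homomorphism $\psi_Z:Z\to C^*(Z)$ such that (i) for every $C^*$-algebra $\mathfrak{A}$ and every $JB^*$-triple homomorphism $\varphi:Z\to\mathfrak{A}$ there exists a $*$-homomorphism $C^*(\varphi):C^*(Z)\to\mathfrak{A}$ with $C^*(\varphi)\circ\psi_Z=\varphi$; (ii) $C^*(Z)$ is generated as a $C^*$-algebra by $\psi_Z(Z)$. (b) There exist, uniquely up to TRO-isomorphism, a TRO $T^*(Z)$ and a $JB^*$-triple homomorphism $\rho_Z:Z\to T^*(Z)$ such that (i) for every TRO $T$ and every $JB^*$-triple homomorphism $\alpha:Z\to T$ there exists a TRO-homomorphism $T^*(\alpha):T^*(Z)\to T$ with $T^*(\alpha)\circ\rho_Z=\alpha$; (ii) $T^*(Z)$ is generated as a TRO by $\rho_Z(Z)$.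
   Context: A $JB^*$-triple system is a complex Banach space $Z$ with a sesquilinear map $Z\times Z\ni(x,y)\mapsto x\Box y\in B(Z)$ (bounded operators on $Z$) such that $\{x,y,z\}:=(x\Box y)(z)$ is continuous in $(x,y,z)$, symmetric in the outer variables $x,z$, satisfies $\|\{x,x,x\}\|=\|x\|^3$ and the Jordan triple identity $\{a,b,\{x,y,z\}\}=\{\{a,b,x\},y,z\}-\{x,\{b,a,y\},z\}+\{x,y,\{a,b,z\}\}$, and each $x\Box x$ is hermitian (i.e. $\exp(it(x\Box x))$ is isometric for all $t\in\mathbb{R}$) with non-negative spectrum. A $JB^*$-triple homomorphism is a linear map preserving the triple product. A TRO (ternary ring of operators) is a closed subspace $T\subseteq B(H)$, $H$ a Hilbert space, with $xy^*z\in T$ for all $x,y,z\in T$. A TRO-homomorphism is a linear map preserving the ternary product $xy^*z$; a TRO-isomorphism is a bijective one. The TRO generated by a subset is the smallest closed subspace containing it and closed under $xy^*z$. Every $C^*$-algebra and every TRO is a $JB^*$-triple system under $\{a,b,c\}=\frac12(ab^*c+cb^*a)$. *)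

(* Defs.v *)
From HB Require Import structures.
From mathcomp Require Import all_boot all_order all_algebra.
From mathcomp Require Import sesquilinear.
From mathcomp Require Import complex.
From mathcomp Require Import all_classical all_reals all_analysis.

Set Implicit Arguments.
Unset Strict Implicit.
Unset Printing Implicit Defensive.

Import Order.TTheory GRing.Theory Num.Theory.
Import numFieldNormedType.Exports.

Local Open Scope classical_set_scope.
Local Open Scope ring_scope.
Local Open Scope complex_scope.

(* Complex Banach spaces are [completeNormedModType R[i]] for [R : realType]:
   the norm takes its values in [R[i]], where [0 <= z] entails that [z] is real.
   [U -> V] carries the pointwise module structure, so that B(V) and its
   subspaces are represented as sets of functions. *)

Section BoundedOperators.
Context {R : realType}.
Implicit Types V W : normedModType R[i].

Definition bounded_op V W : set (V -> W) :=
  [set f | linear f /\ exists M : R[i], forall x, `|f x| <= M * `|x|].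

(* Pointwise value of the (norm convergent) exponential series of [f]. *)
Definition op_exp V (f : V -> V) (x : V) : V :=
  limn (series (fun n => (n`!%:R : R[i])^-1 *: iter n f x)).

Definition hermitian_op V (f : V -> V) : Prop :=
  forall (t : R) (x : V), `|op_exp (('i * t%:C) *: f) x| = `|x|.

Definition invertible_op V (f : V -> V) : Prop :=
  exists g : V -> V, [/\ bounded_op g, f \o g = id & g \o f = id].

Definition op_spectrum V (f : V -> V) : set R[i] :=
  [set l | ~ invertible_op (l *: (id : V -> V) - f)].

(* [`|A u - B u| <= e * `|u|] for all [u] says that the operator norm of
   [A - B] is at most [e]. *)
Definition op_closed V W (T : set (V -> W)) : Prop :=
  forall A, bounded_op A ->
    (forall e : R[i], 0 < e ->
       exists2 B, T B & forall u, `|A u - B u| <= e * `|u|) ->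
    T A.

End BoundedOperators.

(* [box x y z] is (x [] y)(z) = {x, y, z}. *)
HB.mixin Record CompleteNormedModule_isJBTriple (R : realType) Z
    of CompleteNormedModule R[i] Z := {
  box : Z -> Z -> Z -> Z ;
  box_bounded : forall x y, bounded_op (box x y) ;
  box_linearl : forall (a : R[i]) (x x' y : Z),
    box (a *: x + x') y = a *: box x y + box x' y ;
  box_antilinearr : forall (a : R[i]) (x y y' : Z),
    box x (a *: y + y') = a^* *: box x y + box x y' ;
  box_continuous : continuous (fun p : Z * Z * Z => box p.1.1 p.1.2 p.2) ;
  box_sym : forall x y z : Z, box x y z = box z y x ;
  box_norm : forall x : Z, `|box x x x| = `|x| ^+ 3 ;
  box_jordan : forall a b x y z : Z,
    box a b (box x y z) =
      box (box a b x) y z - box x (box b a y) z + box x y (box a b z) ;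
  box_hermitian : forall x : Z, hermitian_op (box x x) ;
  box_spectrum : forall (x : Z) (l : R[i]), op_spectrum (box x x) l -> 0 <= l
}.

#[short(type="jbTripleType")]
HB.structure Definition JBTriple (R : realType) :=
  {Z of CompleteNormedModule R[i] Z & CompleteNormedModule_isJBTriple R Z}.

(* Not assumed to be unital, hence not built on a library ring structure. *)
HB.mixin Record CompleteNormedModule_isCStarAlgebra (R : realType) A
    of CompleteNormedModule R[i] A := {
  cmul : A -> A -> A ;
  cstar : A -> A ;
  cmulA : associative cmul ;
  cmul_linearl : forall y, linear (cmul^~ y) ;
  cmul_linearr : forall x, linear (cmul x) ;
  cstar_antilinear : forall (a : R[i]) (x y : A),
    cstar (a *: x + y) = a^* *: cstar x + cstar y ;
  cstarK : involutive cstar ;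
  cstarM : forall x y, cstar (cmul x y) = cmul (cstar y) (cstar x) ;
  cmul_norm : forall x y, `|cmul x y| <= `|x| * `|y| ;
  cstar_norm : forall x, `|cmul (cstar x) x| = `|x| ^+ 2
}.

#[short(type="cstarAlgType")]
HB.structure Definition CStarAlgebra (R : realType) :=
  {A of CompleteNormedModule R[i] A & CompleteNormedModule_isCStarAlgebra R A}.

HB.mixin Record CompleteNormedModule_isHilbert (R : realType) H
    of CompleteNormedModule R[i] H := {
  inner : {dot H for Num.conj} ;
  inner_norm : forall x : H, inner x x = `|x| ^+ 2
}.

#[short(type="hilbertType")]
HB.structure Definition Hilbert (R : realType) :=
  {H of CompleteNormedModule R[i] H & CompleteNormedModule_isHilbert R H}.

Definition triple_hom (K : pzRingType) (U V : lmodType K)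
    (tU : U -> U -> U -> U) (tV : V -> V -> V -> V) (f : U -> V) : Prop :=
  linear f /\ forall x y z, f (tU x y z) = tV (f x) (f y) (f z).

Section CStarAlgebras.
Context {R : realType}.
Implicit Types A B : cstarAlgType R.

Definition cstar_triple A (a b c : A) : A :=
  2^-1 *: (cmul (cmul a (cstar b)) c + cmul (cmul c (cstar b)) a).

Definition star_hom A B (f : A -> B) : Prop :=
  [/\ linear f, {morph f : x y / cmul x y} & {morph f : x / cstar x}].

Definition star_iso A B (f : A -> B) : Prop := star_hom f /\ bijective f.

Definition cstar_subalgebra A (S : set A) : Prop :=
  [/\ S 0, forall (a : R[i]) x y, S x -> S y -> S (a *: x + y),
      forall x y, S x -> S y -> S (cmul x y),
      forall x, S x -> S (cstar x) & closed S].

Definition cstar_generated A (G : set A) : set A :=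
  smallest (@cstar_subalgebra A) G.

Definition universal_cstar (Z : jbTripleType R) A (psi : Z -> A) : Prop :=
  [/\ triple_hom (@box R Z) (@cstar_triple A) psi,
      (forall B (phi : Z -> B),
         triple_hom (@box R Z) (@cstar_triple B) phi ->
         exists2 f : A -> B, star_hom f & f \o psi = phi)
    & cstar_generated (range psi) = setT].

End CStarAlgebras.

Section TernaryRingsOfOperators.
Context {R : realType}.
Implicit Types H : hilbertType R.

(* Every bounded operator has exactly one adjoint, by Riesz representation;
   the default value 0 is only used for functions that have none. *)
Definition adjoint H (f : H -> H) : H -> H :=
  xget 0 [set g : H -> H | forall u v, inner (f u) v = inner u (g v)].

Definition ternary H (x y z : H -> H) : H -> H := x \o adjoint y \o z.

Definition tro_triple H (a b c : H -> H) : H -> H :=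
  2^-1 *: (ternary a b c + ternary c b a).

Definition is_tro H (T : set (H -> H)) : Prop :=
  [/\ T `<=` @bounded_op R H H,
      T 0,
      forall (a : R[i]) x y, T x -> T y -> T (a *: x + y),
      forall x y z, T x -> T y -> T z -> T (ternary x y z)
    & op_closed T].

Definition tro_generated H (G : set (H -> H)) : set (H -> H) :=
  smallest (@is_tro H) G.

(* Only the restriction of [f] to [T] is meaningful. *)
Definition tro_hom H1 H2 (T1 : set (H1 -> H1)) (T2 : set (H2 -> H2))
    (f : (H1 -> H1) -> (H2 -> H2)) : Prop :=
  [/\ set_fun T1 T2 f,
      forall (a : R[i]) x y, T1 x -> T1 y -> f (a *: x + y) = a *: f x + f y
    & forall x y z, T1 x -> T1 y -> T1 z ->
        f (ternary x y z) = ternary (f x) (f y) (f z)].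

Definition tro_iso H1 H2 (T1 : set (H1 -> H1)) (T2 : set (H2 -> H2))
    (f : (H1 -> H1) -> (H2 -> H2)) : Prop :=
  tro_hom T1 T2 f /\ set_bij T1 T2 f.

Definition jb_hom_tro (Z : jbTripleType R) H (T : set (H -> H))
    (rho : Z -> H -> H) : Prop :=
  triple_hom (@box R Z) (@tro_triple H) rho /\ forall z, T (rho z).

Definition universal_tro (Z : jbTripleType R) H (T : set (H -> H))
    (rho : Z -> H -> H) : Prop :=
  [/\ is_tro T,
      jb_hom_tro T rho,
      (forall (K : hilbertType R) (S : set (K -> K)) (alpha : Z -> K -> K),
         is_tro S -> jb_hom_tro S alpha ->
         exists2 f : (H -> H) -> (K -> K), tro_hom T S f & f \o rho = alpha)
    & tro_generated (range rho) = T].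

End TernaryRingsOfOperators.

(* Main.v *)
(* Every triple homomorphism phi from Z to a C*-algebra satisfies |phi z| <= c(z) with
   c(z) independent of phi.  Hence the *-algebra of formal *-polynomials in the points
   of Z carries a largest C*-seminorm for which all triple homomorphisms of a given
   class become continuous; its separated completion is the universal C*-algebra of
   that class.  The class of all triple homomorphisms into C*-algebras gives C*(Z).
   The class of those into some B(K) gives an algebra A that is isometrically
   represented on a Hilbert direct sum, and T*(Z) is the TRO generated by Z there;
   a triple homomorphism alpha into a TRO in B(K) extends to A and restricts to T*(Z).
   Uniqueness follows from the same automatic continuity: the set where a composite
   of homomorphisms is the identity is closed.

   For the bound, put D y = {z, z, y} and suppose |D| < s = |phi z|^2.  Then
   [+-s - D] is invertible on Z, which gives solutions d of [+-2 s d - h d - d h = 2 h]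
   for h = phi z (phi z)^*.  Since h is self-adjoint of norm s, multiplying by suitable
   powers of h on both sides shows that no such d exist; the estimate behind this is
   h^k - h^(k+2) -> 0 for s = 1, which is deduced from the C*-identity alone. *)

From HB Require Import structures.
Require Import Defs.
From mathcomp Require Import all_boot all_order all_algebra.
From mathcomp Require Import sesquilinear complex ring lra.
From mathcomp Require Import all_classical all_reals all_analysis.

Set Implicit Arguments.
Unset Strict Implicit.
Unset Printing Implicit Defensive.

Import Order.TTheory GRing.Theory Num.Theory.
Import numFieldNormedType.Exports.

Local Open Scope classical_set_scope.
Local Open Scope ring_scope.
Local Open Scope complex_scope.

(** * Real-valued norms and sequences *)

(** The bound replaces spectral theory. A self-adjoint h of norm s has s or -s in its spectrum;
    since phi z (phi z)^* is not known to be positive here, both signs of s have to be used. Scaled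
    to s = 1, the equations would read 0 = 2 at the spectral value 1 and 0 = -2 at -1. The elements
    h^n + h^(n+1) and h^n - h^(n+1) stand in for eigenvectors: h moves the first, and -h the second,
    only by h^n - h^(n+2). No unit, character or state enters: everything rests on |x^* x| = |x|^2
    for polynomials in h without constant term. Size is the other obstacle. The homomorphisms from Z
    into all C*-algebras form a large type, so C*(Z) cannot be cut out of the product of their
    targets. It consists instead of classes of sequences of formal terms over Z, and the large
    family enters only through propositions and suprema of sets of reals. *)

HB.lock Definition rnorm (R : realType) (V : normedModType R[i]) (x : V) : R :=
  complex.Re `|x|.
HB.lock Definition cnorm (R : realType) (a : R[i]) : R := complex.Re `|a|.

Section RealNorm.
Context {R : realType}.
Implicit Types (V W : normedModType R[i]) (r e : R).

(** Norms take values in [R[i]], whose order is partial; estimates are made on the real values, in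
    the totally ordered field [R], and transferred by this equation. *)
Lemma rnormE V (x : V) : `|x| = (rnorm x)%:C.
Proof. by rewrite rnorm.unlock RRe_real// normr_real. Qed.

Lemma rnorm_ge0 V (x : V) : 0 <= rnorm x.
Proof. by rewrite -ler0c -rnormE. Qed.

Lemma rnorm0 V : rnorm (0 : V) = 0.
Proof. by rewrite rnorm.unlock normr0. Qed.

Lemma rnorm_eq0 V (x : V) : rnorm x = 0 -> x = 0.
Proof. by move=> x0; apply/normr0_eq0; rewrite rnormE x0. Qed.

Lemma rnormN V (x : V) : rnorm (- x) = rnorm x.
Proof. by rewrite rnorm.unlock normrN. Qed.

Lemma rnormB V (x y : V) : rnorm (x - y) = rnorm (y - x).
Proof. by rewrite rnorm.unlock distrC. Qed.

Lemma rnormD V (x y : V) : rnorm (x + y) <= rnorm x + rnorm y.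
Proof. by rewrite -lecR rmorphD/= -!rnormE ler_normD. Qed.

Lemma rnorm_triangle V (y x z : V) : rnorm (x - z) <= rnorm (x - y) + rnorm (y - z).
Proof. by rewrite -[x - z](subrKA y) rnormD. Qed.

Lemma rnorm_triangle_lt V (y x z : V) e :
  rnorm (x - y) < e / 2 -> rnorm (y - z) < e / 2 -> rnorm (x - z) < e.
Proof. by move=> h1 h2; rewrite (le_lt_trans (rnorm_triangle y _ _))// [e]splitr ltrD. Qed.

Lemma rnorm_distl V (x y : V) : rnorm x <= rnorm y + rnorm (x - y).
Proof. by rewrite -{1}[x](subrK y) addrC rnormD. Qed.

Lemma cnormE (a : R[i]) : `|a| = (cnorm a)%:C.
Proof. by rewrite cnorm.unlock RRe_real// normr_real. Qed.

Lemma cnorm_ge0 (a : R[i]) : 0 <= cnorm a.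
Proof. by rewrite -ler0c -cnormE. Qed.

Lemma cnorm_gt0 (a : R[i]) : (0 < cnorm a) = (a != 0).
Proof. by rewrite -normr_gt0 cnormE (ltcR 0). Qed.

Lemma cnormM (a b : R[i]) : cnorm (a * b) = cnorm a * cnorm b.
Proof. by apply: complexI; rewrite rmorphM/= -!cnormE normrM. Qed.

Lemma cnormD (a b : R[i]) : cnorm (a + b) <= cnorm a + cnorm b.
Proof. by rewrite -lecR rmorphD/= -!cnormE ler_normD. Qed.

Lemma cnormV (a : R[i]) : cnorm a^-1 = (cnorm a)^-1.
Proof. by apply: complexI; rewrite fmorphV/= -!cnormE normfV. Qed.

Lemma cnormN (a : R[i]) : cnorm (- a) = cnorm a.
Proof. by rewrite cnorm.unlock normrN. Qed.

Lemma cnorm_real r : cnorm r%:C = `|r|.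
Proof. by apply: complexI; rewrite -cnormE normc_def/= expr0n/= addr0 sqrtr_sqr. Qed.

Lemma cnorm_nat n : cnorm (n%:R : R[i]) = n%:R.
Proof. by rewrite cnorm.unlock normr_nat raddfMn. Qed.

Lemma cnorm0 : cnorm (0 : R[i]) = 0.
Proof. by rewrite (cnorm_nat 0). Qed.

Lemma cnorm_i : cnorm ('i : R[i]) = 1.
Proof. by apply: complexI; rewrite -cnormE normc_def/= expr0n expr1n/= add0r sqrtr1. Qed.

Lemma cnorm_conj (a : R[i]) : cnorm (Num.conj a) = cnorm a.
Proof. by apply: complexI; rewrite -!cnormE !normc_def; case: a => x y/=; rewrite sqrrN. Qed.

Lemma Re_le_cnorm (a : R[i]) : complex.Re a <= cnorm a.
Proof.
rewrite -lecR -cnormE normc_def lecR (le_trans (ler_norm _))//.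
by rewrite -sqrtr_sqr ler_wsqrtr// lerDl sqr_ge0.
Qed.

Lemma rnormZ V (a : R[i]) (x : V) : rnorm (a *: x) = cnorm a * rnorm x.
Proof. by apply: complexI; rewrite rmorphM/= -rnormE -cnormE -rnormE normrZ. Qed.

Lemma ball_rnorm V (x y : V) e : ball x e%:C y <-> rnorm (x - y) < e.
Proof. by rewrite -ball_normE /ball_/= rnormE ltcR. Qed.

Lemma gt0_complex (e : R[i]) : 0 < e -> exists2 r : R, 0 < r & e = r%:C.
Proof.
move=> e0; exists (complex.Re e); last by rewrite RRe_real// gtr0_real.
by move: e0; rewrite ltcE => /andP[].
Qed.

Lemma eventually_invS_lt e : 0 < e ->
  exists N, forall n, (N <= n)%N -> n.+1%:R^-1 < e.
Proof.
move=> e0; exists (Num.bound e^-1) => n Nn.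
have h : e^-1 < (Num.bound e^-1)%:R by rewrite archi_boundP// invr_ge0 ltW.
by rewrite invf_plt ?posrE// (lt_le_trans h)// ler_nat leqW.
Qed.

Definition cauchy_seq V (u : nat -> V) : Prop :=
  forall e, 0 < e -> exists N, forall m n, (N <= m)%N -> (N <= n)%N ->
    rnorm (u m - u n) < e.

Definition seq_lim V (u : nat -> V) (l : V) : Prop :=
  forall e, 0 < e -> exists N, forall n, (N <= n)%N -> rnorm (u n - l) < e.

Lemma seq_lim_uniq V (u : nat -> V) l l' : seq_lim u l -> seq_lim u l' -> l = l'.
Proof.
move=> ul ul'; apply/eqP; rewrite -subr_eq0; apply/eqP/rnorm_eq0.
apply/eqP; rewrite eq_le rnorm_ge0 andbT leNgt; apply/negP => d0.
have h0 : 0 < rnorm (l - l') / 2 by rewrite divr_gt0.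
have [N1 H1] := ul _ h0; have [N2 H2] := ul' _ h0.
have := H1 _ (leq_maxl N1 N2); have := H2 _ (leq_maxr N1 N2).
have := rnorm_triangle (u (maxn N1 N2)) l l'.
rewrite (rnormB l (u _)); lra.
Qed.

Lemma seq_limD V (u v : nat -> V) l k :
  seq_lim u l -> seq_lim v k -> seq_lim (fun n => u n + v n) (l + k).
Proof.
move=> ul vk e e0; have h0 : 0 < e / 2 by rewrite divr_gt0.
have [N1 H1] := ul _ h0; have [N2 H2] := vk _ h0.
exists (maxn N1 N2) => n; rewrite geq_max => /andP[/H1 h1 /H2 h2].
by rewrite opprD addrACA (le_lt_trans (rnormD _ _))//; lra.
Qed.

Lemma seq_lim_bounded V W (f : V -> W) (u : nat -> V) l (c : R) :
    (forall n, rnorm (f (u n) - f l) <= c * rnorm (u n - l)) ->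
  seq_lim u l -> seq_lim (fun n => f (u n)) (f l).
Proof.
move=> fc ul e e0.
have c0 : 0 < `|c| + 1 by rewrite ltr_wpDl.
have [N H] := ul _ (divr_gt0 e0 c0); exists N => n /H.
rewrite ltr_pdivlMr// => h; apply: le_lt_trans (fc n) _.
apply: le_lt_trans h; rewrite mulrC ler_wpM2l ?rnorm_ge0//.
by rewrite (le_trans (ler_norm _))// lerDl.
Qed.

Lemma seq_limZ V (a : R[i]) (u : nat -> V) l :
  seq_lim u l -> seq_lim (fun n => a *: u n) (a *: l).
Proof.
by apply: (@seq_lim_bounded V V ( *:%R a) u l (cnorm a)) => n; rewrite -scalerBr rnormZ.
Qed.

Lemma seq_lim_norm_le V (u : nat -> V) l (c : R) :
  seq_lim u l -> (forall n, rnorm (u n) <= c) -> rnorm l <= c.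
Proof.
move=> ul uc; apply/ler_addgt0Pr => e e0.
have [N /(_ _ (leqnn N)) H] := ul _ e0.
rewrite (le_trans (rnorm_distl l (u N)))// rnormB.
by have := uc N; lra.
Qed.

Lemma closed_approx V (S : set V) x : closed S ->
  (forall e, 0 < e -> exists2 y, S y & rnorm (x - y) < e) -> S x.
Proof.
move=> clS Sx; apply: clS => B /nbhs_ballP[e /= /gt0_complex[r r0 ->]] xB.
have [y Sy xy] := Sx _ r0.
by exists y; split => //; apply/xB/ball_rnorm.
Qed.

Lemma approx_closed V (S : set V) :
  (forall x, (forall e, 0 < e -> exists2 y, S y & rnorm (x - y) < e) -> S x) ->
  closed S.
Proof.
move=> SP x clx; apply: SP => e e0.
have e0' : 0 < e%:C :> R[i] by rewrite (ltcR 0 e).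
have [y [Sy /ball_rnorm xy]] := clx _ (nbhsx_ballx x _ e0').
by exists y.
Qed.

Lemma cauchy_seq_lim (V : completeNormedModType R[i]) (u : nat -> V) :
  cauchy_seq u -> exists l, seq_lim u l.
Proof.
move=> uC; have uc : cauchy (u n @[n --> \oo]).
  apply: cauchy_exP => e /gt0_complex[r r0 ->].
  have [N H] := uC _ r0; exists (u N); exists N => // n /= Nn.
  by apply/ball_rnorm; apply: H.
have /cvgrPdist_lt ul : cvg (u n @[n --> \oo]) by exact: cauchy_cvg.
exists (lim (u n @[n --> \oo])) => e e0.
have e0' : 0 < e%:C :> R[i] by rewrite (ltcR 0 e).
have [N _ H] := ul _ e0'; exists N => n /H/=.
by rewrite rnormB rnormE ltcR.
Qed.

(** A Cauchy filter contains a ball of radius 1/(n+1) for every n. Two such balls meet, so their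
    centres form a Cauchy sequence, and its limit is the limit of the filter. *)
Lemma seq_complete V :
  (forall u : nat -> V, cauchy_seq u -> exists l, seq_lim u l) ->
  forall F : set_system V, ProperFilter F -> cauchy F -> cvg F.
Proof.
move=> Vc F FF /cauchyP Fc.
have e0 n : 0 < (n.+1%:R^-1 : R)%:C :> R[i] by rewrite (ltcR 0) invr_gt0.
have [u uF] := choice (fun n => Fc _ (e0 n)).
have uu m n : rnorm (u m - u n) < m.+1%:R^-1 + n.+1%:R^-1.
  have [x [/ball_rnorm h1 /ball_rnorm h2]] := filter_ex (filterI (uF m) (uF n)).
  by rewrite (le_lt_trans (rnorm_triangle x _ _))// (rnormB x) ltrD.
have [|l ul] := Vc u.
  move=> e e0'; have [N H] := eventually_invS_lt (divr_gt0 e0' (ltr0n _ 2)).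
  exists N => m n /H h1 /H h2.
  by rewrite (lt_trans (uu m n))// [e]splitr ltrD.
apply/cvg_ex; exists l; apply/fcvgrPdist_lt => _ /gt0_complex[e e0' ->].
have [N1 H1] := ul _ (divr_gt0 e0' (ltr0n _ 2)).
have [N2 H2] := eventually_invS_lt (divr_gt0 e0' (ltr0n _ 2)).
have {}H1 := H1 _ (leq_maxl N1 N2); have {}H2 := H2 _ (leq_maxr N1 N2).
apply: filterS (uF (maxn N1 N2)) => x /ball_rnorm h.
rewrite rnormE ltcR (le_lt_trans (rnorm_triangle (u (maxn N1 N2)) _ _))//.
by rewrite rnormB addrC [e]splitr ltrD// (lt_trans h).
Qed.

Lemma geometric_cauchy V (u : nat -> V) (c q : R) : 0 <= q < 1 ->
  (forall n, rnorm (u n.+1 - u n) <= c * q ^+ n) -> cauchy_seq u.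
Proof.
move=> /andP[q0 q1] uq.
have q1' : 0 < 1 - q by rewrite subr_gt0.
(* Keeping the factor 1 - q^k makes the induction step an identity. *)
have tail n k : rnorm (u (n + k)%N - u n) <= c * q ^+ n * (1 - q ^+ k) / (1 - q).
  elim: k => [|k IH]; first by rewrite addn0 !subrr rnorm0 mulr0 mul0r.
  rewrite addnS (le_trans (rnorm_triangle (u (n + k)%N) _ _))//.
  rewrite (le_trans (lerD (uq _) IH))// exprD exprS ler_pdivlMr// mulrDl divfK ?gt_eqF//.
  rewrite le_eqVlt; apply/orP; left; apply/eqP; ring.
have c0 : 0 <= c by have := le_trans (rnorm_ge0 _) (uq 0); rewrite expr0 mulr1.
move=> e e0.
have := @cvg_expr R q; rewrite ger0_norm// => /(_ q1)/cvgrPdist_lt.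
have d0 : 0 < e * (1 - q) / (2 * (c + 1)).
  by rewrite divr_gt0 ?mulr_gt0// ltr_wpDl.
move=> /(_ _ d0)[N _ H]; exists N => m n Nm Nn.
wlog nm : m n Nm Nn / (n <= m)%N => [wl|].
  by case/orP: (leq_total m n) => mn; [rewrite rnormB|]; apply: wl.
rewrite -(subnKC nm) (le_lt_trans (tail _ _))//.
have := H n Nn; rewrite /= sub0r normrN ger0_norm ?exprn_ge0// => qn.
rewrite ltr_pdivrMr//.
have k0 : 0 <= q ^+ (m - n) by rewrite exprn_ge0.
have := qn; rewrite ltr_pdivlMr ?mulr_gt0 ?ltr_wpDl// => {}qn.
have qn0 : 0 <= q ^+ n by rewrite exprn_ge0.
have : c * q ^+ n * (1 - q ^+ (m - n)) <= c * q ^+ n.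
  by rewrite ler_piMr ?mulr_ge0// gerBl.
have : 0 < e * (1 - q) by rewrite mulr_gt0.
nra.
Qed.

End RealNorm.

(** * Completion of a space given by a family of evaluations *)

(** The seminorm in view is the supremum over j of |ev_j u|, finite by [pb_bounded]. The index type
    may be much larger than the carrier; the fibres are complete so that limits can be taken in each
    of them. *)
Record prebanach (R : realType) := Prebanach {
  pb_car : Type ;
  pb_zero : pb_car ;
  pb_add : pb_car -> pb_car -> pb_car ;
  pb_scale : R[i] -> pb_car -> pb_car ;
  pb_idx : Type ;
  pb_fib : pb_idx -> completeNormedModType R[i] ;
  pb_ev : forall j, pb_car -> pb_fib j ;
  pb_ev0 : forall j, pb_ev j pb_zero = 0 ;
  pb_evD : forall j u v, pb_ev j (pb_add u v) = pb_ev j u + pb_ev j v ;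
  pb_evZ : forall j a u, pb_ev j (pb_scale a u) = a *: pb_ev j u ;
  pb_bounded : forall u, exists M : R, forall j, rnorm (pb_ev j u) <= M
}.

Section CompletionDef.
Context {R : realType} (P : prebanach R).
Local Notation V := (pb_car P).
Local Notation ev := (@pb_ev R P).

Definition pb_cauchy (u : nat -> V) : Prop :=
  forall e : R, 0 < e -> exists N, forall m n, (N <= m)%N -> (N <= n)%N ->
    forall j, rnorm (ev j (u m) - ev j (u n)) <= e.

Definition pb_lim (u : nat -> V) j : pb_fib j :=
  xget 0 [set l | seq_lim (fun n => ev j (u n)) l].

Definition pb_class (u : nat -> V) : set (nat -> V) :=
  [set v | pb_cauchy v /\ forall j, pb_lim v j = pb_lim u j].

(** A subset of the product of all fibres would be as large as the index type. Classes of sequences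
    in [pb_car P] avoid this, as the indices occur only inside a proposition. *)
Definition completion : Type :=
  {C : set (nat -> V) | exists u, pb_cauchy u /\ C = pb_class u}.

Definition cpl_class u (uc : pb_cauchy u) : completion :=
  exist _ (pb_class u) (ex_intro _ u (conj uc erefl)).

Definition cpl_rep (x : completion) : nat -> V := projT1 (cid (proj2_sig x)).

Definition cpl_ev j (x : completion) : pb_fib j := pb_lim (cpl_rep x) j.

Lemma cpl_rep_cauchy x : pb_cauchy (cpl_rep x).
Proof. by rewrite /cpl_rep; case: cid => u []. Qed.

Lemma cpl_repE x : proj1_sig x = pb_class (cpl_rep x).
Proof. by rewrite /cpl_rep; case: cid => u []. Qed.

Lemma pb_limP u j : pb_cauchy u -> seq_lim (fun n => ev j (u n)) (pb_lim u j).
Proof.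
move=> uc; have [|l ul] := @cauchy_seq_lim R _ (fun n => ev j (u n)).
  move=> e e0; have [N H] := uc (e / 2) (divr_gt0 e0 (ltr0n _ 2)).
  exists N => m n Nm Nn; rewrite (le_lt_trans (H _ _ Nm Nn j))//.
  by rewrite ltr_pdivrMr// ltr_pMr// ltr1n.
by rewrite /pb_lim; case: xgetP => [k -> //|/(_ l)].
Qed.

Lemma pb_limE u j l : pb_cauchy u -> seq_lim (fun n => ev j (u n)) l ->
  pb_lim u j = l.
Proof. by move=> uc; apply/seq_lim_uniq/pb_limP. Qed.

Lemma cpl_ev_lim x j : seq_lim (fun n => ev j (cpl_rep x n)) (cpl_ev j x).
Proof. exact/pb_limP/cpl_rep_cauchy. Qed.

Lemma cpl_ev_class u (uc : pb_cauchy u) j : cpl_ev j (cpl_class uc) = pb_lim u j.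
Proof.
have : pb_class u (cpl_rep (cpl_class uc)); last by case.
by rewrite -[pb_class u]/(proj1_sig (cpl_class uc)) cpl_repE; split=> //; apply: cpl_rep_cauchy.
Qed.

Lemma cpl_ev_classE u (uc : pb_cauchy u) j l :
  seq_lim (fun n => ev j (u n)) l -> cpl_ev j (cpl_class uc) = l.
Proof. by move=> ul; rewrite cpl_ev_class; apply: pb_limE. Qed.

(** The evaluations separate points by construction of the classes; all algebraic laws of the
    completion are therefore checked fibre by fibre. *)
Lemma cpl_ext x y : (forall j, cpl_ev j x = cpl_ev j y) -> x = y.
Proof.
move=> xy; suff: proj1_sig x = proj1_sig y.
  by case: x y {xy} => [C CP] [D DP] /= CD; move: CP DP; rewrite CD => ? ?; congr exist.
rewrite !cpl_repE;apply/seteqP.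
split=> u [uc H]; split=> // j; rewrite H.
  exact: xy.
exact: esym (xy j).
Qed.

Lemma pb_cauchy_const (v : V) : pb_cauchy (fun=> v).
Proof. by move=> e e0; exists 0%N => *; rewrite subrr rnorm0 ltW. Qed.

Lemma pb_cauchyD u v : pb_cauchy u -> pb_cauchy v ->
  pb_cauchy (fun n => pb_add (u n) (v n)).
Proof.
move=> uc vc e e0.
have [N1 H1] := uc _ (divr_gt0 e0 (ltr0n _ 2)).
have [N2 H2] := vc _ (divr_gt0 e0 (ltr0n _ 2)).
exists (maxn N1 N2) => m n; rewrite !geq_max => /andP[m1 m2] /andP[n1 n2] j.
rewrite !pb_evD opprD addrACA (le_trans (rnormD _ _))//.
by rewrite [e]splitr lerD ?H1 ?H2.
Qed.

Lemma pb_cauchy_lipschitz (f : V -> V) (c : R) :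
    (forall (u v : V) (e : R), (forall j, rnorm (ev j u - ev j v) <= e) ->
       forall j, rnorm (ev j (f u) - ev j (f v)) <= c * e) ->
  forall u, pb_cauchy u -> pb_cauchy (fun n => f (u n)).
Proof.
move=> fc u uc e e0.
have c0 : 0 < `|c| + 1 by rewrite ltr_wpDl.
have [N H] := uc _ (divr_gt0 e0 c0); exists N => m n Nm Nn j.
rewrite (le_trans (fc _ _ _ (H _ _ Nm Nn) j))// mulrA ler_pdivrMr//.
by rewrite mulrC ler_pM2l// (le_trans (ler_norm _))// lerDl.
Qed.

Lemma pb_cauchyZ a u : pb_cauchy u -> pb_cauchy (fun n => pb_scale a (u n)).
Proof.
apply: (@pb_cauchy_lipschitz _ (cnorm a)) => {}u v e H j.
by rewrite !pb_evZ -scalerBr rnormZ ler_wpM2l ?cnorm_ge0.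
Qed.

Definition cpl_emb (v : V) : completion := cpl_class (pb_cauchy_const v).

Definition cpl_add (x y : completion) : completion :=
  cpl_class (pb_cauchyD (cpl_rep_cauchy x) (cpl_rep_cauchy y)).

Definition cpl_scale a (x : completion) : completion :=
  cpl_class (pb_cauchyZ a (cpl_rep_cauchy x)).

Lemma cpl_ev_emb j v : cpl_ev j (cpl_emb v) = ev j v.
Proof. by apply: cpl_ev_classE => e e0; exists 0%N => *; rewrite subrr rnorm0. Qed.

Lemma cpl_ev_add j x y : cpl_ev j (cpl_add x y) = cpl_ev j x + cpl_ev j y.
Proof.
apply: cpl_ev_classE.
rewrite (_ : (fun n => _) = (fun n => ev j (cpl_rep x n) + ev j (cpl_rep y n))).
  by apply: seq_limD; apply: cpl_ev_lim.
by apply/funext => n; rewrite pb_evD.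
Qed.

Lemma cpl_ev_scale j a x : cpl_ev j (cpl_scale a x) = a *: cpl_ev j x.
Proof.
apply: cpl_ev_classE.
rewrite (_ : (fun n => _) = (fun n => a *: ev j (cpl_rep x n))).
  by apply: seq_limZ; apply: cpl_ev_lim.
by apply/funext => n; rewrite pb_evZ.
Qed.

(** Adjoining 0 keeps the set nonempty when there is no index. *)
Definition cpl_rnorm (x : completion) : R :=
  sup [set r | r = 0 \/ exists j, r = rnorm (cpl_ev j x)].

Lemma pb_cauchy_bounded u : pb_cauchy u -> exists2 M : R, 0 <= M &
  exists N, forall n, (N <= n)%N -> forall j, rnorm (ev j (u n)) <= M.
Proof.
move=> uc; have [N H] := uc _ ltr01.
have [M HM] := pb_bounded (u N).
exists (`|M| + 1); first by rewrite addr_ge0.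
exists N => n Nn j; rewrite (le_trans (rnorm_distl _ (ev j (u N))))// lerD ?H//.
by rewrite (le_trans (HM j))// ler_norm.
Qed.

Lemma cpl_bounded x : exists M : R, forall j, rnorm (cpl_ev j x) <= M.
Proof.
have [M _ [N H]] := pb_cauchy_bounded (cpl_rep_cauchy x); exists M => j.
apply: (@seq_lim_norm_le _ _ (fun n => ev j (cpl_rep x (N + n)%N))).
  move=> e /(cpl_ev_lim x j)[N' H']; exists N' => n Nn; apply: H'.
  by rewrite (leq_trans Nn)// leq_addl.
by move=> n; apply: H; rewrite leq_addr.
Qed.

Lemma cpl_rnorm_has_sup x : has_sup [set r | r = 0 \/ exists j, r = rnorm (cpl_ev j x)].
Proof.
split; first by exists 0; left.
have [M HM] := cpl_bounded x; exists (Num.max 0 M) => _ [->|[j ->]].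
  by rewrite le_max lexx.
by rewrite le_max HM orbT.
Qed.

Lemma cpl_ev_le j x : rnorm (cpl_ev j x) <= cpl_rnorm x.
Proof. by apply: (sup_upper_bound (cpl_rnorm_has_sup x)); right; exists j. Qed.

Lemma cpl_rnorm_ge0 x : 0 <= cpl_rnorm x.
Proof. by apply: (sup_upper_bound (cpl_rnorm_has_sup x)); left. Qed.

Lemma cpl_rnorm_le x (c : R) : 0 <= c ->
  (forall j, rnorm (cpl_ev j x) <= c) -> cpl_rnorm x <= c.
Proof.
move=> c0 xc; apply: ge_sup; first by case: (cpl_rnorm_has_sup x).
by move=> _ [->|[j ->]].
Qed.

HB.instance Definition _ := gen_eqMixin completion.
HB.instance Definition _ := gen_choiceMixin completion.

Lemma cpl_addA : associative cpl_add.
Proof. by move=> x y z; apply: cpl_ext => j; rewrite !cpl_ev_add addrA. Qed.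

Lemma cpl_addC : commutative cpl_add.
Proof. by move=> x y; apply: cpl_ext => j; rewrite !cpl_ev_add addrC. Qed.

Lemma cpl_add0 : left_id (cpl_emb (pb_zero P)) cpl_add.
Proof.
by move=> x; apply: cpl_ext => j; rewrite cpl_ev_add cpl_ev_emb pb_ev0 add0r.
Qed.

Lemma cpl_addN : left_inverse (cpl_emb (pb_zero P)) (cpl_scale (-1)) cpl_add.
Proof.
move=> x; apply: cpl_ext => j.
by rewrite cpl_ev_add cpl_ev_scale cpl_ev_emb pb_ev0 scaleN1r addNr.
Qed.

HB.instance Definition _ :=
  GRing.isZmodule.Build completion cpl_addA cpl_addC cpl_add0 cpl_addN.

Lemma cpl_evD j (x y : completion) : cpl_ev j (x + y) = cpl_ev j x + cpl_ev j y.
Proof. exact: cpl_ev_add. Qed.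

Lemma cpl_ev0 j : cpl_ev j (0 : completion) = 0.
Proof. by rewrite cpl_ev_emb pb_ev0. Qed.

Lemma cpl_evN j (x : completion) : cpl_ev j (- x) = - cpl_ev j x.
Proof. by rewrite cpl_ev_scale scaleN1r. Qed.

Lemma cpl_scalerA a b (x : completion) :
  cpl_scale a (cpl_scale b x) = cpl_scale (a * b) x.
Proof. by apply: cpl_ext => j; rewrite !cpl_ev_scale scalerA. Qed.

Lemma cpl_scale1r : left_id 1 cpl_scale.
Proof. by move=> x; apply: cpl_ext => j; rewrite !cpl_ev_scale scale1r. Qed.

Lemma cpl_scalerDr : right_distributive cpl_scale +%R.
Proof.
by move=> a x y; apply: cpl_ext => j; rewrite !(cpl_ev_scale, cpl_evD) scalerDr.
Qed.

Lemma cpl_scalerDl (x : completion) : {morph cpl_scale^~ x : a b / a + b}.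
Proof.
by move=> a b; apply: cpl_ext => j; rewrite !(cpl_ev_scale, cpl_evD) scalerDl.
Qed.

HB.instance Definition _ := GRing.Zmodule_isLmodule.Build R[i] completion
  cpl_scalerA cpl_scale1r cpl_scalerDr cpl_scalerDl.

Lemma cpl_evZ j a (x : completion) : cpl_ev j (a *: x) = a *: cpl_ev j x.
Proof. exact: cpl_ev_scale. Qed.

Lemma cpl_evB j (x y : completion) : cpl_ev j (x - y) = cpl_ev j x - cpl_ev j y.
Proof. by rewrite cpl_evD cpl_evN. Qed.

Definition cpl_norm (x : completion) : R[i] := (cpl_rnorm x)%:C.

Lemma cpl_normD x y : cpl_norm (x + y) <= cpl_norm x + cpl_norm y.
Proof.
rewrite -rmorphD/= lecR cpl_rnorm_le ?addr_ge0 ?cpl_rnorm_ge0// => j.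
by rewrite cpl_evD (le_trans (rnormD _ _))// lerD ?cpl_ev_le.
Qed.

Lemma cpl_rnormZ_le a (x : completion) : cpl_rnorm (a *: x) <= cnorm a * cpl_rnorm x.
Proof.
apply: cpl_rnorm_le; first by rewrite mulr_ge0 ?cpl_rnorm_ge0 ?cnorm_ge0.
by move=> j; rewrite cpl_evZ rnormZ ler_wpM2l ?cnorm_ge0 ?cpl_ev_le.
Qed.

Lemma cpl_normZ a (x : completion) : cpl_norm (a *: x) = `|a| * cpl_norm x.
Proof.
rewrite cnormE -rmorphM/=; congr (_ %:C); apply/eqP; rewrite eq_le cpl_rnormZ_le/=.
have [->|a0] := eqVneq a 0; first by rewrite cnorm0 mul0r cpl_rnorm_ge0.
have := cpl_rnormZ_le a^-1 (a *: x).
by rewrite scalerA mulVf// scale1r cnormV mulrC ler_pdivlMr ?cnorm_gt0// mulrC.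
Qed.

Lemma cpl_norm0_eq0 (x : completion) : cpl_norm x = 0 -> x = 0.
Proof.
move=> /complexI x0; apply: cpl_ext => j; rewrite cpl_ev0; apply: rnorm_eq0.
by apply/eqP; rewrite eq_le rnorm_ge0 andbT -x0 cpl_ev_le.
Qed.

HB.instance Definition _ := Lmodule_isNormed.Build R[i] completion
  cpl_normD cpl_normZ cpl_norm0_eq0.

Lemma cpl_rnormE (x : completion) : rnorm x = cpl_rnorm x.
Proof. by rewrite rnorm.unlock. Qed.

Lemma cpl_dense (x : completion) (e : R) : 0 < e ->
  exists v, rnorm (x - cpl_emb v) <= e.
Proof.
move=> e0; have [N H] := cpl_rep_cauchy x e0.
exists (cpl_rep x N); rewrite cpl_rnormE cpl_rnorm_le ?ltW// => j.
rewrite cpl_evB cpl_ev_emb.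
apply: (@seq_lim_norm_le _ _ (fun n => ev j (cpl_rep x (N + n)%N) - ev j (cpl_rep x N))).
  move=> d /(cpl_ev_lim x j)[N' H']; exists N' => n Nn.
  rewrite opprB addrA subrK; apply: H'.
  by rewrite (leq_trans Nn)// leq_addl.
by move=> n; apply: H; rewrite ?leq_addr.
Qed.

(** Replace each x_n by an element v_n of the dense carrier at distance at most 1/(n+1); then v is
    itself a Cauchy sequence, and its class is the limit. *)
Lemma cpl_seq_complete (x : nat -> completion) :
  cauchy_seq x -> exists l, seq_lim x l.
Proof.
move=> xc.
have e0 n : 0 < n.+1%:R^-1 :> R by rewrite invr_gt0.
have [v xv] := choice (fun n => cpl_dense (x n) (e0 n)).
have vc : pb_cauchy v.
  move=> e e0'; have e2 : 0 < e / 2 by rewrite divr_gt0.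
  have e4 : 0 < e / 2 / 2 by rewrite divr_gt0.
  have [N1 H1] := xc _ e4; have [N2 H2] := eventually_invS_lt e2.
  have [N3 H3] := eventually_invS_lt e4.
  exists (maxn N1 (maxn N2 N3)) => m n.
  rewrite !geq_max => /andP[m1 /andP[m2 _]] /andP[n1 /andP[_ n3]] j.
  rewrite -!cpl_ev_emb -cpl_evB (le_trans (cpl_ev_le j _))// -cpl_rnormE ltW//.
  apply: (rnorm_triangle_lt (y := x m)).
    by rewrite rnormB (le_lt_trans (xv m))// H2.
  apply: (rnorm_triangle_lt (y := x n)); first exact: H1.
  by rewrite (le_lt_trans (xv n))// H3.
exists (cpl_class vc) => e e0'; have e2 : 0 < e / 2 by rewrite divr_gt0.
have e4 : 0 < e / 2 / 2 by rewrite divr_gt0.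
have [N1 H1] := vc _ e4; have [N2 H2] := eventually_invS_lt e2.
exists (maxn N1 N2) => n; rewrite !geq_max => /andP[n1 n2].
apply: (rnorm_triangle_lt (y := cpl_emb (v n))).
  by rewrite (le_lt_trans (xv n))// H2.
apply: (@le_lt_trans _ _ (e / 2 / 2)); last by rewrite ltr_pdivrMr// ltr_pMr// ltr1n.
rewrite cpl_rnormE cpl_rnorm_le ?ltW// => j.
rewrite cpl_evB cpl_ev_emb cpl_ev_class.
apply: (@seq_lim_norm_le _ _ (fun k => ev j (v n) - ev j (v (N1 + k)%N))).
  move=> d /(pb_limP j vc)[N' H']; exists N' => k Nk.
  rewrite opprB addrC addrA subrK rnormB; apply: H'.
  by rewrite (leq_trans Nk)// leq_addl.
by move=> k; apply: H1; rewrite ?leq_addr.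
Qed.

HB.instance Definition _ := Uniform_isComplete.Build completion
  (seq_complete cpl_seq_complete).

End CompletionDef.

(** * Polynomials in one element of a C*-algebra *)

Section CStarBasics.
Context {R : realType} {A : cstarAlgType R}.
Implicit Types x y z : A.

Lemma cmulDl x y z : cmul (x + y) z = cmul x z + cmul y z.
Proof. by have := cmul_linearl z 1 x y; rewrite !scale1r. Qed.

Lemma cmulDr x y z : cmul x (y + z) = cmul x y + cmul x z.
Proof. by have := cmul_linearr x 1 y z; rewrite !scale1r. Qed.

Lemma cmul0l x : cmul 0 x = 0.
Proof. by apply: (addrI (cmul 0 x)); rewrite -cmulDl !addr0. Qed.

Lemma cmul0r x : cmul x 0 = 0.
Proof. by apply: (addrI (cmul x 0)); rewrite -cmulDr !addr0. Qed.

Lemma cmulZl a x y : cmul (a *: x) y = a *: cmul x y.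
Proof. by have := cmul_linearl y a x 0; rewrite !addr0 cmul0l addr0. Qed.

Lemma cmulZr a x y : cmul x (a *: y) = a *: cmul x y.
Proof. by have := cmul_linearr x a y 0; rewrite !addr0 cmul0r addr0. Qed.

Lemma cmulNl x y : cmul (- x) y = - cmul x y.
Proof. by rewrite -scaleN1r cmulZl scaleN1r. Qed.

Lemma cmulNr x y : cmul x (- y) = - cmul x y.
Proof. by rewrite -scaleN1r cmulZr scaleN1r. Qed.

Lemma cmulBl x y z : cmul (x - y) z = cmul x z - cmul y z.
Proof. by rewrite cmulDl cmulNl. Qed.

Lemma cmulBr x y z : cmul x (y - z) = cmul x y - cmul x z.
Proof. by rewrite cmulDr cmulNr. Qed.

Lemma cstarD x y : cstar (x + y) = cstar x + cstar y.
Proof. by have := cstar_antilinear 1 x y; rewrite rmorph1 !scale1r. Qed.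

Lemma cstar0 : cstar (0 : A) = 0.
Proof. by apply: (addrI (cstar 0)); rewrite -cstarD !addr0. Qed.

Lemma cstarZ a x : cstar (a *: x) = Num.conj a *: cstar x.
Proof. by have := cstar_antilinear a x 0; rewrite !addr0 cstar0 addr0. Qed.

Lemma cstarB x y : cstar (x - y) = cstar x - cstar y.
Proof. by rewrite cstarD -scaleN1r cstarZ rmorphN1 scaleN1r. Qed.

Lemma rnorm_cmul x y : rnorm (cmul x y) <= rnorm x * rnorm y.
Proof. by have := cmul_norm x y; rewrite !rnormE -rmorphM lecR. Qed.

Lemma rnorm_cmul_le x y (c d : R) : rnorm x <= c -> rnorm y <= d ->
  rnorm (cmul x y) <= c * d.
Proof.
by move=> xc yd; rewrite (le_trans (rnorm_cmul _ _))// ler_pM ?rnorm_ge0.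
Qed.

Lemma rnorm_cstar_cmul x : rnorm (cmul (cstar x) x) = rnorm x ^+ 2.
Proof. by apply: complexI; rewrite rmorphXn/= -!rnormE cstar_norm. Qed.

Lemma rnorm_cstar x : rnorm (cstar x) = rnorm x.
Proof.
have le y : rnorm y <= rnorm (cstar y).
  have := rnorm_cmul (cstar y) y; rewrite rnorm_cstar_cmul expr2.
  have [->|y0] := eqVneq (rnorm y) 0; first by rewrite rnorm_ge0.
  by rewrite ler_pM2r// lt_neqAle eq_sym y0 rnorm_ge0.
by apply/eqP; rewrite eq_le -{2}[x]cstarK !le.
Qed.

Lemma rnorm_cmul_cstar x : rnorm (cmul x (cstar x)) = rnorm x ^+ 2.
Proof. by rewrite -{1}[x]cstarK rnorm_cstar_cmul rnorm_cstar. Qed.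

End CStarBasics.

Section PolynomialCalculus.
Context {R : realType} {A : cstarAlgType R}.
Implicit Types (h : A) (p q : {poly R[i]}).

(** Without a unit the lowest power is h itself: [cpow h n] is h^(n+1). All exponents below are
    shifted by one. *)
Definition cpow h n : A := iter n (cmul h) h.

Lemma cmul_cpow h m n : cmul (cpow h m) (cpow h n) = cpow h (m + n).+1.
Proof. by elim: m => [//|m IH]; rewrite /= -cmulA IH. Qed.

Lemma cpow_sqr h n : cpow (cmul h h) n = cpow h (n + n).+1.
Proof.
elim: n => [//|n IH]; rewrite /= IH -cmulA.
by rewrite addnS.
Qed.

Lemma rnorm_cpow_le1 h n : rnorm h <= 1 -> rnorm (cpow h n) <= 1.
Proof.
by move=> h1; elim: n => [//|n IH]; rewrite -[1]mulr1 rnorm_cmul_le.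
Qed.

(* A has no unit: [peval h p] stands for h p(h), so that the constant 1 is sent to h. *)
Definition peval h p : A := \sum_(i < size p) p`_i *: cpow h i.

Lemma pevalE h n p : (size p <= n)%N -> peval h p = \sum_(i < n) p`_i *: cpow h i.
Proof.
move=> pn; rewrite -(subnKC pn) big_split_ord/= [X in _ + X]big1 ?addr0// => i _.
by rewrite nth_default ?scale0r// leq_addr.
Qed.

Lemma pevalD h p q : peval h (p + q) = peval h p + peval h q.
Proof.
rewrite !(@pevalE h (maxn (size p) (size q))) ?leq_maxl ?leq_maxr ?size_polyD//.
by rewrite -big_split; apply: eq_bigr => i _; rewrite coefD scalerDl.
Qed.

Lemma pevalZ h a p : peval h (a *: p) = a *: peval h p.
Proof.
rewrite !(@pevalE h (size p)) ?size_scale_leq// scaler_sumr.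
by apply: eq_bigr => i _; rewrite coefZ scalerA.
Qed.

Lemma pevalB h p q : peval h (p - q) = peval h p - peval h q.
Proof. by rewrite pevalD -scaleN1r pevalZ scaleN1r. Qed.

Lemma pevalXn h n : peval h 'X^n = cpow h n.
Proof.
rewrite (@pevalE h n.+1) ?size_polyXn// (bigD1 (inord n))//= inordK//.
rewrite coefXn eqxx scale1r big1 ?addr0// => i.
rewrite -val_eqE/= inordK// => /negPf ni.
by rewrite coefXn ni scale0r.
Qed.

Lemma peval1 h : peval h 1 = h.
Proof. by rewrite -(expr0 'X) pevalXn. Qed.

Lemma peval0 h : peval h 0 = 0.
Proof. by rewrite /peval size_poly0 big_ord0. Qed.

Lemma pevalXM h p : peval h ('X * p) = cmul h (peval h p).
Proof.
have hsum (I : Type) (r : seq I) (F : I -> A) :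
    cmul h (\sum_(i <- r) F i) = \sum_(i <- r) cmul h (F i).
  by elim/big_rec2: _ => [|i x y _ <-]; rewrite ?cmul0r ?cmulDr.
rewrite (@pevalE h (size p).+1); last first.
  by rewrite (leq_trans (size_polyMleq _ _))// size_polyX.
rewrite big_ord_recl coefXM/= scale0r add0r /peval hsum.
by apply: eq_bigr => i _; rewrite coefXM/= cmulZr.
Qed.

(** The extra ['X] is the effect of the shift: h p(h) times h q(h) is h times h p(h) q(h).
    Identities between powers of h thereby become polynomial identities. *)
Lemma pevalM h p q : cmul (peval h p) (peval h q) = peval h ('X * p * q).
Proof.
elim/poly_ind: p => [|p c IH]; first by rewrite mulr0 mul0r peval0 cmul0l.
rewrite pevalD cmulDl [p * 'X]mulrC pevalXM -cmulA IH -pevalXM mulrDr mulrDl pevalD.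
congr (_ + _); first by rewrite !mulrA.
rewrite -[c%:P]mulr1 mul_polyC pevalZ peval1 cmulZl -scalerAr -scalerAl mulr1.
by rewrite pevalZ pevalXM.
Qed.

Lemma cstar_cpow h n : cstar h = h -> cstar (cpow h n) = cpow h n.
Proof.
move=> hs; elim: n => [//|n IH]; rewrite /= cstarM IH hs -[h in RHS]/(cpow h 0).
by rewrite -[h in LHS]/(cpow h 0) !cmul_cpow addn0 add0n.
Qed.

Lemma cstar_peval h p : cstar h = h ->
  cstar (peval h p) = peval h (map_poly (@conjc R) p).
Proof.
move=> hs; rewrite [in RHS](@pevalE h (size p)) ?size_poly// /peval.
have ssum (I : Type) (r : seq I) (F : I -> A) :
    cstar (\sum_(i <- r) F i) = \sum_(i <- r) cstar (F i).
  by elim/big_rec2: _ => [|i x y _ <-]; rewrite ?cstar0 ?cstarD.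
by rewrite ssum; apply: eq_bigr => i _; rewrite cstarZ cstar_cpow// coef_map.
Qed.

End PolynomialCalculus.

(** * Decay of h^k - h^(k+2) and an unsolvable equation *)

Section PowerDecay.
Context {R : realType} {A : cstarAlgType R}.
Implicit Types (h : A).

Lemma rnorm_cpow_sa2 h n : cstar h = h ->
  rnorm (cpow h (n + n).+1) = rnorm (cpow h n) ^+ 2.
Proof.
by move=> hs; rewrite -cmul_cpow -[X in cmul X _](cstar_cpow _ hs) rnorm_cstar_cmul.
Qed.

(** By the C*-identity the powers with exponent 2^j (m = 0, 1, 3, 7, ... in [cpow h m]) have norm 1.
    Multiplying by further powers cannot increase the norm, so every smaller exponent gives norm at
    least 1. *)
Lemma rnorm_cpow_ge1 h n : cstar h = h -> rnorm h = 1 -> 1 <= rnorm (cpow h n).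
Proof.
move=> hs h1.
have [m nm hm] : exists2 m, (n <= m)%N & rnorm (cpow h m) = 1.
  elim: n => [|n [m nm hm]]; first by exists 0%N.
  exists (m + m).+1; first by rewrite ltnS (leq_trans nm)// leq_addr.
  by rewrite rnorm_cpow_sa2// hm expr1n.
move: nm; rewrite leq_eqVlt => /orP[/eqP ->|nm]; first by rewrite hm.
rewrite -hm -(subnKC nm) addSn -cmul_cpow (le_trans (rnorm_cmul _ _))//.
by rewrite ler_piMr ?rnorm_ge0// rnorm_cpow_le1// h1.
Qed.

(** The element is h^2 - 2 h^4. The triangle inequality would bound its square by 9 only. Adding i
    (2 h^3 - h^5) gives w with w^* w = h^4 + h^10, because the cross terms of the two squares
    cancel; hence |w|^2 <= 2, and the element is the real part of w. *)
Lemma rnorm_h2_sub_2h4 h : cstar h = h -> rnorm h <= 1 ->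
  rnorm (peval h ('X - 'X^3 *+ 2)) ^+ 2 <= 2.
Proof.
move=> hs h1.
pose p : {poly R[i]} := 'X - 'X^3 *+ 2; pose q : {poly R[i]} := 'X^2 *+ 2 - 'X^4.
have ps : cstar (peval h p) = peval h p.
  by rewrite cstar_peval// rmorphB rmorphMn/= map_polyXn map_polyX.
have qs : cstar (peval h q) = peval h q.
  by rewrite cstar_peval// rmorphB rmorphMn/= !map_polyXn.
pose w := peval h p + 'i *: peval h q.
have wsE : cstar w = peval h p - 'i *: peval h q.
  rewrite cstarD cstarZ ps qs; congr (_ + _).
  by rewrite -scaleNr; congr (_ *: _); apply/eqP; rewrite eq_complex/= oppr0 !eqxx.
have ii : ('i : R[i]) * 'i = -1 by rewrite -expr2 sqr_i.
have ww : cmul (cstar w) w = peval h ('X^3 + 'X^9).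
  rewrite wsE cmulBl !cmulDr !cmulZl !cmulZr scalerA ii scaleN1r.
  rewrite !pevalM (_ : 'X * q * p = 'X * p * q); last by ring.
  rewrite opprD opprK [- _ + _]addrC addrACA subrr addr0 -pevalD; congr peval; rewrite /p /q; ring.
have wn : rnorm w ^+ 2 <= 2.
  rewrite -rnorm_cstar_cmul ww pevalD !pevalXn (le_trans (rnormD _ _))//.
  by rewrite -[2]/(1 + 1) lerD// rnorm_cpow_le1.
have -> : peval h p = 2^-1 *: (w + cstar w).
  rewrite wsE addrACA subrr addr0 -[peval h p]scale1r -scalerDl scalerA.
  by rewrite mulVf ?scale1r// pnatr_eq0.
have pw : rnorm (2^-1 *: (w + cstar w)) <= rnorm w.
  rewrite rnormZ cnormV cnorm_nat ler_pdivrMl// (le_trans (rnormD _ _))//.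
  by rewrite rnorm_cstar mulr_natl mulr2n.
by rewrite (le_trans _ wn)// ler_sqr ?nnegrE ?rnorm_ge0.
Qed.

(* [t^3 - t^4 = (t^2 - (t - 2 t^2)^2) / 4] with [t = h^2]. *)
Lemma rnorm_h6_sub_h8 h : cstar h = h -> rnorm h <= 1 ->
  rnorm (cpow h 5 - cpow h 7) <= 3 / 4.
Proof.
move=> hs h1.
have := rnorm_h2_sub_2h4 hs h1.
set q : {poly R[i]} := 'X - _ => qn.
have E : 4%:R *: (cpow h 5 - cpow h 7) = cpow h 3 - cmul (peval h q) (peval h q).
  rewrite pevalM -!pevalXn -!pevalB -pevalZ; congr peval.
  by rewrite /q scaler_nat; ring.
have : rnorm (4%:R *: (cpow h 5 - cpow h 7)) <= 1 + 2.
  rewrite E (le_trans (rnormD _ _))// rnormN lerD ?rnorm_cpow_le1//.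
  by rewrite (le_trans (rnorm_cmul _ _))// -expr2.
rewrite rnormZ cnorm_nat; lra.
Qed.

(* [2 (t^2m - t^(2m+1)) = (t^2m - t^(2m+2)) + (t^m - t^(m+1))^2] with [t = h^2],
   whose first term has the same shape as the last one, with [t^2] for [t]. *)
Lemma rnorm_cpow_double (c : R) k : 0 <= c ->
  (forall h, cstar h = h -> rnorm h <= 1 -> rnorm (cpow h k - cpow h k.+2) <= c) ->
  forall h, cstar h = h -> rnorm h <= 1 ->
    rnorm (cpow h (k + k).+1 - cpow h (k + k).+3) <= (c + c ^+ 2) / 2.
Proof.
move=> c0 H h hs h1.
have h2s : cstar (cmul h h) = cmul h h by rewrite cstarM hs.
have h21 : rnorm (cmul h h) <= 1 by rewrite -[1]mulr1 rnorm_cmul_le.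
have := H _ h2s h21; rewrite !cpow_sqr => H1.
have := H _ hs h1; set d := _ - _ => H2.
have E : 2%:R *: (cpow h (k + k).+1 - cpow h (k + k).+3) =
  (cpow h (k + k).+1 - cpow h (k.+2 + k.+2).+1) + cmul d d.
  rewrite /d -!pevalXn -!pevalB pevalM -pevalD -pevalZ; congr peval.
  rewrite scaler_nat !addnS !addSn !exprS exprD; ring.
have : rnorm (2%:R *: (cpow h (k + k).+1 - cpow h (k + k).+3)) <= c + c ^+ 2.
  rewrite E (le_trans (rnormD _ _))// lerD//.
  by rewrite (le_trans (rnorm_cmul _ _))// expr2 ler_pM ?rnorm_ge0.
rewrite rnormZ cnorm_nat ler_pdivlMr// mulrC; exact.
Qed.

(** Starting at c = 3/4, the map c -> (c + c^2) / 2 shrinks c by at least the factor (1 + 3/4) / 2 =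
    7/8. The choice of k is uniform in h because the doubling step applies its hypothesis to h^2 as
    well as to h. *)
Lemma cpow_decay (e : R) : 0 < e -> exists k, forall h, cstar h = h ->
  rnorm h <= 1 -> rnorm (cpow h k - cpow h k.+2) <= e.
Proof.
move=> e0.
have step n : exists k, forall h, cstar h = h -> rnorm h <= 1 ->
    rnorm (cpow h k - cpow h k.+2) <= 3 / 4 * (7 / 8) ^+ n.
  elim: n => [|n [k H]].
    by exists 5%N => h hs h1; rewrite expr0 mulr1 rnorm_h6_sub_h8.
  have q0 : 0 <= (7 / 8 : R) ^+ n by rewrite exprn_ge0.
  have q1 : (7 / 8 : R) ^+ n <= 1 by rewrite exprn_ile1//; lra.
  exists (k + k).+1 => h hs h1.
  rewrite (le_trans (rnorm_cpow_double _ H hs h1)) ?mulr_ge0// [_ ^+ n.+1]exprS.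
  move: q0 q1; move: (_ ^+ n) => q q0 q1.
  have qq : q * q <= q by rewrite ler_piMr.
  by rewrite exprMn [q ^+ 2]expr2 ler_pdivrMr//; lra.
have := @cvg_expr R (7 / 8); rewrite ger0_norm// => /(_ _)/cvgrPdist_lt.
have q1 : (7 / 8 : R) < 1 by lra.
move=> /(_ q1 e e0)[N _ /(_ N (leqnn N))].
rewrite /= sub0r normrN ger0_norm ?exprn_ge0// => qe.
have [k H] := step N; exists k => h hs h1; rewrite (le_trans (H h hs h1))//.
have q0 : 0 <= (7 / 8 : R) ^+ N by rewrite exprn_ge0.
by rewrite (le_trans _ (ltW qe))// ler_piMl//; lra.
Qed.

(** Read 2 d - h d - d h as (1 - h) d + d (1 - h): the factor c on the left nearly annihilates the
    first summand and the factor c on the right the second. *)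
Lemma rnorm_sandwich (h c d : A) (e : R) : cmul c h = cmul h c -> rnorm c <= 2 ->
  rnorm (c - cmul h c) <= e ->
  rnorm (cmul (cmul c (2%:R *: d - cmul h d - cmul d h)) c) <= 4 * e * rnorm d.
Proof.
move=> ch c2 he; have he' : rnorm (c - cmul c h) <= e by rewrite ch.
have -> : cmul (cmul c (2%:R *: d - cmul h d - cmul d h)) c =
  cmul (cmul (c - cmul c h) d) c + cmul (cmul c d) (c - cmul h c).
  rewrite scaler_nat mulr2n !(cmulBr, cmulBl, cmulDr, cmulDl) !cmulA.
  by rewrite -!addrA; congr (_ + _); rewrite addrCA.
have e0 : 0 <= e := le_trans (rnorm_ge0 _) he.
rewrite (le_trans (rnormD _ _))//.
have H1 : rnorm (cmul (cmul (c - cmul c h) d) c) <= e * rnorm d * 2.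
  by rewrite rnorm_cmul_le// rnorm_cmul_le.
have H2 : rnorm (cmul (cmul c d) (c - cmul h c)) <= 2 * rnorm d * e.
  by rewrite rnorm_cmul_le// rnorm_cmul_le.
by rewrite (le_trans (lerD H1 H2))// le_eqVlt; apply/orP; left; apply/eqP; ring.
Qed.

(** The elements c1 and c2 below are nearly fixed by h and by -h. Sandwiching the first equation
    between c1 and the second between c2 makes both c1 h c1 and c2 h c2 small, while their
    difference 4 h^(2k+4) has norm at least 4. *)
Lemma sylvester_unsolvable (h d1 d2 : A) : cstar h = h -> rnorm h = 1 ->
  2%:R *: d1 - cmul h d1 - cmul d1 h = 2%:R *: h ->
  2%:R *: d2 + cmul h d2 + cmul d2 h = 2%:R *: h -> False.
Proof.
move=> hs h1 E1 E2; have hle : rnorm h <= 1 by rewrite h1.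
(* With e = 1 / D, the two sandwiched terms have norms at most 2 e |d1| and 2 e |d2|, whose sum is
   below 2; the summand 1 keeps D positive. *)
pose D := rnorm d1 + rnorm d2 + 1.
have D0 : 0 < D by rewrite ltr_wpDl ?addr_ge0 ?rnorm_ge0.
have [k Hk] := cpow_decay (divr_gt0 ltr01 D0).
have {}Hk := Hk h hs hle; set e := 1 / D in Hk.
pose c1 := peval h (('X^k : {poly R[i]}) + 'X^(k.+1)).
pose c2 := peval h (('X^k : {poly R[i]}) - 'X^(k.+1)).
have hE : h = peval h 1 by rewrite peval1.
have comm p : cmul (peval h p) h = cmul h (peval h p).
  by rewrite {2 3}hE !pevalM; congr peval; ring.
have c12 : rnorm c1 <= 2.
  rewrite /c1 pevalD !pevalXn (le_trans (rnormD _ _))// -[2]/(1 + 1).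
  by rewrite lerD// rnorm_cpow_le1.
have c22 : rnorm c2 <= 2.
  rewrite /c2 pevalB !pevalXn (le_trans (rnormD _ _))// rnormN -[2]/(1 + 1).
  by rewrite lerD// rnorm_cpow_le1.
have e1 : rnorm (c1 - cmul h c1) <= e.
  rewrite (_ : _ - _ = cpow h k - cpow h k.+2)// -!pevalXn -pevalB.
  by rewrite /c1 -pevalXM -pevalB !exprS; congr peval; ring.
have e2 : rnorm (c2 - cmul (- h) c2) <= e.
  rewrite (_ : _ - _ = cpow h k - cpow h k.+2)// -!pevalXn -pevalB.
  rewrite cmulNl opprK.
  by rewrite /c2 -pevalXM -pevalD !exprS; congr peval; ring.
have comm2 : cmul c2 (- h) = cmul (- h) c2.
  by rewrite cmulNl cmulNr comm.
have := rnorm_sandwich d1 (comm _) c12 e1.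
have := rnorm_sandwich d2 comm2 c22 e2.
rewrite cmulNl cmulNr !opprK E1 E2 !cmulZr !cmulZl !rnormZ cnorm_nat => n2 n1.
(* (1 + h)^2 - (1 - h)^2 = 4 h, multiplied by h^(2k+2) and by h. *)
have : rnorm (4%:R *: cpow h (k + k).+3) <=
    rnorm (cmul (cmul c1 h) c1) + rnorm (cmul (cmul c2 h) c2).
  rewrite -(rnormN (cmul (cmul c2 h) c2)); apply: le_trans (rnormD _ _).
  rewrite le_eqVlt; apply/orP; left; apply/eqP; congr rnorm.
  rewrite !comm /c1 /c2 -!pevalXM !pevalM -pevalB -pevalXn -pevalZ; congr peval.
  by rewrite scaler_nat !exprS exprD; ring.
rewrite rnormZ cnorm_nat.
have := rnorm_cpow_ge1 (k + k).+3 hs h1.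
have eD : e * D = 1 by rewrite /e mul1r mulVf// gt_eqF.
have d10 := rnorm_ge0 d1; have d20 := rnorm_ge0 d2.
have e0 : 0 < e by rewrite divr_gt0.
move: eD; rewrite /D; nra.
Qed.

End PowerDecay.

(** * Automatic continuity of triple homomorphisms *)

Section AutomaticContinuity.
Context {R : realType}.

Definition subspace (V : lmodType R[i]) (S : set V) : Prop :=
  S 0 /\ forall a x y, S x -> S y -> S (a *: x + y).

(** Linearity is relative to a set because the bound is applied both on whole spaces and on the
    operators of a TRO, where a TRO-homomorphism is meaningful only on the TRO. *)
Definition linear_on (V W : lmodType R[i]) (S : set V) (f : V -> W) : Prop :=
  forall a x y, S x -> S y -> f (a *: x + y) = a *: f x + f y.

Section LinearOn.
Context {V W : lmodType R[i]} {S : set V} {f : V -> W}.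
Hypotheses (subS : subspace S) (linf : linear_on S f).

Lemma subspaceD x y : S x -> S y -> S (x + y).
Proof. by move=> Sx Sy; rewrite -[x]scale1r; apply: subS.2. Qed.

Lemma subspaceZ a x : S x -> S (a *: x).
Proof. by move=> Sx; rewrite -[_ *: _]addr0; apply: subS.2 => //; case: subS. Qed.

Lemma subspaceB x y : S x -> S y -> S (x - y).
Proof. by move=> Sx Sy; rewrite -scaleN1r; apply/subspaceD/subspaceZ. Qed.

Lemma linear_onD x y : S x -> S y -> f (x + y) = f x + f y.
Proof. by move=> Sx Sy; have := linf 1 Sx Sy; rewrite !scale1r. Qed.

Lemma linear_on0 : f 0 = 0.
Proof. by apply: (addrI (f 0)); rewrite -linear_onD ?addr0//; case: subS. Qed.

Lemma linear_onZ a x : S x -> f (a *: x) = a *: f x.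
Proof.
by move=> Sx; have := linf a Sx subS.1; rewrite !addr0 linear_on0 addr0.
Qed.

Lemma linear_onB x y : S x -> S y -> f (x - y) = f x - f y.
Proof.
move=> Sx Sy; have := linear_onD Sx (subspaceZ (-1) Sy).
by rewrite linear_onZ// !scaleN1r.
Qed.

End LinearOn.

Lemma subspaceT (V : lmodType R[i]) : subspace [set: V].
Proof. by []. Qed.

(** Neumann series, run as the iteration of the contraction y -> (x + D y) / l. The iterates stay in
    S, and S is closed. *)
Lemma resolvent_exists (E : completeNormedModType R[i]) (S : set E) (D : E -> E)
    (M : R) (l : R[i]) (x : E) :
  closed S -> subspace S -> linear_on S D -> (forall y, S y -> S (D y)) ->
  (forall y, S y -> rnorm (D y) <= M * rnorm y) -> 0 <= M -> M < cnorm l -> S x ->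
  exists2 y, S y & l *: y - D y = x.
Proof.
move=> clS subS linD SD DM M0 Ml Sx.
have l0 : 0 < cnorm l := le_lt_trans M0 Ml.
have lN0 : l != 0 by rewrite -cnorm_gt0.
pose step y := l^-1 *: (x + D y); pose u n := iter n step 0.
have Sstep y : S y -> S (step y).
  by move=> Sy; apply: (subspaceZ subS); apply: (subspaceD subS) => //; apply: SD.
have Su n : S (u n) by elim: n => [|n IH]; [case: subS|apply: Sstep].
pose q := M / cnorm l.
have q01 : 0 <= q < 1 by rewrite /q divr_ge0 ?(ltW l0)//= ltr_pdivrMr// mul1r.
have stepq y z : S y -> S z -> rnorm (step y - step z) <= q * rnorm (y - z).
  move=> Sy Sz; rewrite /step -scalerBr opprD addrACA subrr add0r -(linear_onB subS linD)//.
  rewrite rnormZ cnormV ler_pdivrMl// mulrA /q mulrCA mulfV ?gt_eqF// mulr1.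
  exact/DM/(subspaceB subS).
have uc : cauchy_seq u.
  apply: (@geometric_cauchy _ _ _ (rnorm (u 1%N)) q) => // n.
  elim: n => [|n IH]; first by rewrite subr0 expr0 mulr1.
  apply: le_trans (stepq _ _ (Su n.+1) (Su n)) _; rewrite exprS mulrCA ler_wpM2l//.
  by case/andP: q01.
have [y uy] := cauchy_seq_lim uc.
have Sy : S y.
  apply: closed_approx => // e /uy[N /(_ _ (leqnn N)) H].
  by exists (u N) => //; rewrite rnormB.
exists y => //.
have yE : step y = y.
  apply: (@seq_lim_uniq _ _ (fun n => step (u n))).
    move=> e /uy[N H]; exists N => n /H h.
    rewrite (le_lt_trans (stepq _ _ (Su _) Sy))// (le_lt_trans _ h)//.
    by rewrite ler_piMl ?rnorm_ge0// ltW//; case/andP: q01.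
  by move=> e /uy[N H]; exists N => n Nn; apply: (H n.+1); rewrite leqW.
by rewrite -{1}yE /step scalerA mulfV// scale1r addrK.
Qed.

(* If M < s := |phi x|^2, solving [+-s y - D y = x] in the domain and multiplying
   the images by (phi x)^* on the right yields the two equations refuted by
   [sylvester_unsolvable] for [h := phi x (phi x)^* / s]. No continuity of [phi]
   is needed to transport these equations. *)
Lemma triple_hom_bound (E : completeNormedModType R[i]) (A : cstarAlgType R)
    (S : set E) (D : E -> E) (phi : E -> A) (M : R) (x : E) :
  closed S -> subspace S -> linear_on S D -> (forall y, S y -> S (D y)) ->
  (forall y, S y -> rnorm (D y) <= M * rnorm y) -> 0 <= M -> S x ->
  linear_on S phi ->
  (forall y, S y -> phi (D y) = cstar_triple (phi x) (phi x) (phi y)) ->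
  rnorm (phi x) ^+ 2 <= M.
Proof.
move=> clS subS linD SD DM M0 Sx linphi phiD; rewrite leNgt; apply/negP => Ms.
set a := phi x in phiD Ms; set s := rnorm a ^+ 2 in Ms.
have s0 : 0 < s := le_lt_trans M0 Ms.
have sN0 : s%:C != 0 :> R[i] by rewrite -cnorm_gt0 cnorm_real normr_gt0 gt_eqF.
pose h := s%:C^-1 *: cmul a (cstar a).
have hs : cstar h = h.
  by rewrite /h cstarZ cstarM cstarK fmorphV/= conj_Creal// complex_real.
have h1 : rnorm h = 1.
  rewrite rnormZ cnormV cnorm_real (gtr0_norm s0) rnorm_cmul_cstar mulVf//.
  by rewrite gt_eqF.
have [l lE] : exists l : bool -> R[i], forall b, l b = (-1) ^+ b * s%:C.
  by exists (fun b : bool => (-1) ^+ b * s%:C).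
have key b : exists d, 2%:R *: (l b *: d) - (cmul (cmul a (cstar a)) d +
    cmul d (cmul a (cstar a))) = 2%:R *: cmul a (cstar a).
  have [|y Sy yE] := @resolvent_exists _ S D M (l b) x clS subS linD SD DM M0 _ Sx.
    by rewrite lE cnormM cnorm_real (gtr0_norm s0) cnorm.unlock normr_sign mul1r.
  exists (cmul (phi y) (cstar a)).
  have := congr1 (fun v => 2%:R *: cmul (phi v) (cstar a)) yE.
  rewrite (linear_onB subS linphi); first last.
  - exact: SD.
  - exact: (subspaceZ subS).
  rewrite phiD//.
  rewrite (linear_onZ subS linphi)// cmulBl scalerBr /cstar_triple !cmulZl.
  by rewrite [2%:R *: (2^-1 *: _)]scalerA mulfV ?pnatr_eq0// scale1r cmulDl -!cmulA.
have [d1 E1] := key false; have [d2 E2] := key true.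
have sE : cmul a (cstar a) = s%:C *: h by rewrite /h scalerA mulfV// scale1r.
clearbody h.
have sC (v : A) : s%:C *: (2%:R *: v) = 2%:R *: (s%:C *: v) by rewrite !scalerA mulrC.
move: E1 E2; rewrite !lE expr0 mul1r expr1 mulN1r sE !cmulZl !cmulZr => E1 E2.
(* [d2] solves -2 d - h d - d h = 2 h up to the factor s, so [- d2] solves the form with plus
   signs. *)
apply: (@sylvester_unsolvable _ _ h d1 (- d2) hs h1); apply: (scalerI sN0).
  by rewrite -addrA -opprD scalerBr scalerDr !sC.
rewrite -addrA !cmulNl !cmulNr -opprD scalerBr scalerDr !sC -E2.
by rewrite scaleNr !scalerN.
Qed.

End AutomaticContinuity.

(** * The C*-algebra generated by a family of triple homomorphisms *)

Section TripleHoms.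
Context {R : realType}.

Lemma bounded_op_rnorm (V W : normedModType R[i]) (f : V -> W) : bounded_op f ->
  linear f /\ exists2 M : R, 0 <= M & forall x, rnorm (f x) <= M * rnorm x.
Proof.
move=> [linf [M fM]]; split=> //; exists (cnorm M); first exact: cnorm_ge0.
move=> x; rewrite -lecR rmorphM/= -cnormE -!rnormE (le_trans (fM x))//.
(* M is merely complex, but M times the norm of x dominates a norm, so it is nonnegative and equal
   to its modulus. *)
have M0 : 0 <= M * `|x| by rewrite (le_trans _ (fM x)).
by rewrite -(ger0_norm M0) normrM normr_id.
Qed.

Lemma linear_setT (V W : lmodType R[i]) (f : V -> W) : linear f -> linear_on setT f.
Proof. by move=> linf a x y _ _; rewrite linf. Qed.

Lemma star_hom_triple (A B : cstarAlgType R) (f : A -> B) : star_hom f ->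
  triple_hom (@cstar_triple R A) (@cstar_triple R B) f.
Proof.
move=> [linf fM fS]; split=> // x y z; have linT := linear_setT linf.
rewrite /cstar_triple (linear_onZ (subspaceT _) linT)//.
by rewrite (linear_onD linT)// !fM fS.
Qed.

(** M is the square root of a bound for the operator [box z z] of Z itself. It is chosen before A
    and phi, which makes suprema over all homomorphisms finite. *)
Lemma jb_hom_bound (Z : jbTripleType R) (z : Z) : exists2 M : R, 0 <= M &
  forall (A : cstarAlgType R) (phi : Z -> A),
    triple_hom (@box R Z) (@cstar_triple R A) phi -> rnorm (phi z) <= M.
Proof.
have [linD [M M0 DM]] := bounded_op_rnorm (box_bounded z z).
exists (Num.sqrt M) => [|A phi [linphi phiD]]; first exact: sqrtr_ge0.
rewrite -[rnorm _]ger0_norm ?rnorm_ge0// -sqrtr_sqr ler_wsqrtr//.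
apply: (@triple_hom_bound _ _ _ setT (box z z)) => //.
  exact: linear_setT.
exact: linear_setT.
Qed.

Lemma seq_lim_cmul (A : cstarAlgType R) (u v : nat -> A) l k :
  seq_lim u l -> seq_lim v k -> seq_lim (fun n => cmul (u n) (v n)) (cmul l k).
Proof.
move=> ul vk e e0; pose c := rnorm l + rnorm k + 1.
have c0 : 0 < c by rewrite ltr_wpDl ?addr_ge0 ?rnorm_ge0.
have [N1 H1] := ul _ (divr_gt0 e0 (mulr_gt0 (ltr0n R 2) c0)).
have [N2 H2] := vk _ (divr_gt0 e0 (mulr_gt0 (ltr0n R 2) c0)).
(* From N3 on, |v_n| <= |k| + 1 <= c. *)
have [N3 H3] := vk _ ltr01.
exists (maxn N1 (maxn N2 N3)) => n; rewrite !geq_max => /and3P[/H1 h1 /H2 h2 /H3 h3].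
apply: (rnorm_triangle_lt (y := cmul l (v n))).
  rewrite -cmulBl (le_lt_trans (rnorm_cmul _ _))//.
  rewrite (@le_lt_trans _ _ (rnorm (u n - l) * c))//.
    rewrite ler_wpM2l ?rnorm_ge0// (le_trans (rnorm_distl _ k))// /c.
    by rewrite -addrA addrCA lerDr// lerD2l ltW || rewrite -addrA ler_wpDl ?rnorm_ge0// lerD2l ltW.
  by rewrite -ltr_pdivlMr// -[ltRHS]mulrA -invfM.
rewrite -cmulBr (le_lt_trans (rnorm_cmul _ _))//.
rewrite (@le_lt_trans _ _ (c * rnorm (v n - k)))//.
  by rewrite ler_wpM2r ?rnorm_ge0// /c -addrA lerDl addr_ge0 ?rnorm_ge0.
by rewrite mulrC -ltr_pdivlMr// -[ltRHS]mulrA -invfM.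
Qed.

Lemma seq_lim_cstar (A : cstarAlgType R) (u : nat -> A) l :
  seq_lim u l -> seq_lim (fun n => cstar (u n)) (cstar l).
Proof.
apply: (@seq_lim_bounded _ _ _ _ _ _ 1) => n.
by rewrite mul1r -cstarB rnorm_cstar.
Qed.

End TripleHoms.

Record triple_family (R : realType) (Z : jbTripleType R) := TripleFamily {
  tf_idx : Type ;
  tf_alg : tf_idx -> cstarAlgType R ;
  tf_map : forall j, Z -> tf_alg j ;
  tf_hom : forall j, triple_hom (@box R Z) (@cstar_triple R (tf_alg j)) (@tf_map j)
}.

(** Raw syntax: no law of a *-algebra holds between terms. Terms with equal evaluations are
    identified in the completion, and there the laws hold because they hold in every target. *)
Inductive star_term (Z K : Type) : Type :=
| TVar of Z
| TZero
| TAdd of star_term Z K & star_term Z K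
| TScale of K & star_term Z K
| TMul of star_term Z K & star_term Z K
| TStar of star_term Z K.

Arguments TZero {Z K}.
Arguments TVar {Z K}.

Fixpoint term_eval (R : realType) (Z : Type) (A : cstarAlgType R) (f : Z -> A)
    (t : star_term Z R[i]) : A :=
  match t with
  | TVar z => f z
  | TZero => 0
  | TAdd t u => term_eval f t + term_eval f u
  | TScale a t => a *: term_eval f t
  | TMul t u => cmul (term_eval f t) (term_eval f u)
  | TStar t => cstar (term_eval f t)
  end.

Section UniversalAlgebra.
Context {R : realType} {Z : jbTripleType R} (F : triple_family Z).
Local Notation term := (star_term Z R[i]).
Local Notation eval j := (term_eval (@tf_map R Z F j)).

Lemma term_eval_bounded (t : term) : exists M : R, forall j, rnorm (eval j t) <= M.
Proof.
suff [M _ H] : exists2 M : R, 0 <= M & forall j, rnorm (eval j t) <= M by exists M.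
elim: t => [z||t [M M0 HM] u [N N0 HN]|a t [M M0 HM]|t [M M0 HM] u [N N0 HN]|t [M M0 HM]].
- have [M M0 HM] := jb_hom_bound z; exists M => // j; exact/HM/tf_hom.
- by exists 0 => // j; rewrite rnorm0.
- by exists (M + N) => [|j]; [rewrite addr_ge0|rewrite (le_trans (rnormD _ _))// lerD].
- exists (cnorm a * M) => [|j]; first by rewrite mulr_ge0 ?cnorm_ge0.
  by rewrite rnormZ ler_wpM2l ?cnorm_ge0.
- by exists (M * N) => [|j]; [rewrite mulr_ge0|rewrite rnorm_cmul_le].
- by exists M => // j; rewrite rnorm_cstar.
Qed.

Definition star_prebanach : prebanach R :=
  @Prebanach R term TZero (@TAdd _ _) (@TScale _ _) (tf_idx F)
    (fun j => tf_alg j : completeNormedModType R[i]) (fun j => eval j)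
    (fun=> erefl) (fun _ _ _ => erefl) (fun _ _ _ => erefl) term_eval_bounded.

Definition univ_alg : Type := completion star_prebanach.

HB.instance Definition _ := CompleteNormedModule.copy univ_alg (completion star_prebanach).

Definition univ_ev (j : tf_idx F) (x : univ_alg) : tf_alg j :=
  @cpl_ev R star_prebanach j x.

Lemma pb_cauchy_mul (u v : nat -> term) :
  @pb_cauchy R star_prebanach u -> @pb_cauchy R star_prebanach v ->
  @pb_cauchy R star_prebanach (fun n => TMul (u n) (v n)).
Proof.
move=> uc vc e e0.
have [M M0 [N1 H1]] := pb_cauchy_bounded uc.
have [K K0 [N2 H2]] := pb_cauchy_bounded vc.
have c0 : 0 < M + K + 1 by rewrite ltr_wpDl ?addr_ge0.
have [N3 H3] := uc _ (divr_gt0 e0 c0); have [N4 H4] := vc _ (divr_gt0 e0 c0).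
exists (maxn (maxn N1 N2) (maxn N3 N4)) => m n.
rewrite !geq_max => /andP[/andP[m1 m2] /andP[m3 m4]] /andP[/andP[n1 n2] /andP[n3 n4]] j.
have := H1 _ m1 j; have := H2 _ n2 j; have := H3 _ _ m3 n3 j; have := H4 _ _ m4 n4 j.
rewrite /=; set x := term_eval _ (u m); set x' := term_eval _ (u n).
set y := term_eval _ (v m); set y' := term_eval _ (v n) => h4 h3 h2 h1.
rewrite (le_trans (rnorm_triangle (cmul x y') _ _))// -cmulBr -cmulBl.
rewrite (le_trans (lerD (rnorm_cmul_le h1 h4) (rnorm_cmul_le h3 h2)))//.
rewrite [_ * K]mulrC -mulrDl mulrCA ler_piMr ?ltW// ltr_pdivrMr// mul1r.
by rewrite ltrDl.
Qed.

Lemma pb_cauchy_star (u : nat -> term) :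
  @pb_cauchy R star_prebanach u -> @pb_cauchy R star_prebanach (fun n => TStar (u n)).
Proof.
apply: (@pb_cauchy_lipschitz _ _ _ 1) => {}u v e H j; rewrite mul1r /=.
by rewrite -cstarB rnorm_cstar; apply: H.
Qed.

Definition univ_mul (x y : univ_alg) : univ_alg :=
  cpl_class (pb_cauchy_mul (cpl_rep_cauchy x) (cpl_rep_cauchy y)).

Definition univ_star (x : univ_alg) : univ_alg :=
  cpl_class (pb_cauchy_star (cpl_rep_cauchy x)).

Lemma univ_ev_mul j x y : univ_ev j (univ_mul x y) = cmul (univ_ev j x) (univ_ev j y).
Proof.
apply: (@cpl_ev_classE R star_prebanach).
exact: (seq_lim_cmul (@cpl_ev_lim R star_prebanach x j) (@cpl_ev_lim R star_prebanach y j)).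
Qed.

Lemma univ_ev_star j x : univ_ev j (univ_star x) = cstar (univ_ev j x).
Proof. apply: (@cpl_ev_classE R star_prebanach).
exact: (seq_lim_cstar (@cpl_ev_lim R star_prebanach x j)). Qed.

Lemma univ_ext x y : (forall j, univ_ev j x = univ_ev j y) -> x = y.
Proof. exact: (@cpl_ext R star_prebanach). Qed.

Lemma univ_ev_linear j : linear (@univ_ev j).
Proof. by move=> a x y; rewrite /univ_ev cpl_evD cpl_evZ. Qed.

Lemma rnorm_univ_ev j (x : univ_alg) : rnorm (univ_ev j x) <= rnorm x.
Proof. by rewrite cpl_rnormE; apply: (@cpl_ev_le R star_prebanach). Qed.

Lemma univ_rnorm_le (x : univ_alg) (c : R) : 0 <= c ->
  (forall j, rnorm (univ_ev j x) <= c) -> rnorm x <= c.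
Proof. by rewrite cpl_rnormE; apply: (@cpl_rnorm_le R star_prebanach). Qed.

Lemma univ_mulA : associative univ_mul.
Proof. by move=> x y z; apply: univ_ext => j; rewrite !univ_ev_mul cmulA. Qed.

Lemma univ_mul_linearl y : linear (univ_mul^~ y).
Proof.
move=> a x z; apply: univ_ext => j.
by rewrite univ_ev_mul !univ_ev_linear !univ_ev_mul cmulDl cmulZl.
Qed.

Lemma univ_mul_linearr x : linear (univ_mul x).
Proof.
move=> a y z; apply: univ_ext => j.
by rewrite univ_ev_mul !univ_ev_linear !univ_ev_mul cmulDr cmulZr.
Qed.

Lemma univ_star_antilinear (a : R[i]) (x y : univ_alg) :
  univ_star (a *: x + y) = Num.conj a *: univ_star x + univ_star y.
Proof.
apply: univ_ext => j.
by rewrite univ_ev_star !univ_ev_linear !univ_ev_star cstarD cstarZ.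
Qed.

Lemma univ_starK : involutive univ_star.
Proof. by move=> x; apply: univ_ext => j; rewrite !univ_ev_star cstarK. Qed.

Lemma univ_starM x y : univ_star (univ_mul x y) = univ_mul (univ_star y) (univ_star x).
Proof.
by apply: univ_ext => j; rewrite !(univ_ev_star, univ_ev_mul) cstarM.
Qed.

Lemma univ_mul_norm x y : `|univ_mul x y| <= `|x| * `|y|.
Proof.
rewrite !rnormE -rmorphM lecR univ_rnorm_le ?mulr_ge0 ?rnorm_ge0// => j.
by rewrite univ_ev_mul rnorm_cmul_le ?rnorm_univ_ev.
Qed.

(** The C*-identity survives the supremum over the fibres because squaring is increasing on
    nonnegative reals; the square root serves for the lower bound. *)
Lemma univ_star_norm x : `|univ_mul (univ_star x) x| = `|x| ^+ 2.
Proof.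
rewrite !rnormE -rmorphXn/=; congr (_ %:C); apply/eqP; rewrite eq_le; apply/andP; split.
  rewrite univ_rnorm_le ?sqr_ge0// => j.
  by rewrite univ_ev_mul univ_ev_star rnorm_cstar_cmul ler_sqr ?nnegrE ?rnorm_ge0 ?rnorm_univ_ev.
rewrite -[leRHS]sqr_sqrtr ?rnorm_ge0// ler_sqr ?nnegrE ?rnorm_ge0 ?sqrtr_ge0//.
apply: univ_rnorm_le => [|j]; first exact: sqrtr_ge0.
rewrite -[leLHS]ger0_norm ?rnorm_ge0// -sqrtr_sqr ler_wsqrtr// -rnorm_cstar_cmul.
by rewrite -univ_ev_star -univ_ev_mul rnorm_univ_ev.
Qed.

HB.instance Definition _ := CompleteNormedModule_isCStarAlgebra.Build R univ_alg
  univ_mulA univ_mul_linearl univ_mul_linearr univ_star_antilinear univ_starK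
  univ_starM univ_mul_norm univ_star_norm.

Lemma univ_ev_star_hom j : star_hom (@univ_ev j).
Proof.
split; [exact: univ_ev_linear|exact: univ_ev_mul|exact: univ_ev_star].
Qed.

Definition univ_emb (t : term) : univ_alg := @cpl_emb R star_prebanach t.

Lemma univ_ev_emb j t : univ_ev j (univ_emb t) = eval j t.
Proof. exact: (@cpl_ev_emb R star_prebanach). Qed.

Definition univ_map (z : Z) : univ_alg := univ_emb (TVar z).

Lemma univ_ev_map j z : univ_ev j (univ_map z) = tf_map j z.
Proof. exact: univ_ev_emb. Qed.

Lemma univ_map_hom : triple_hom (@box R Z) (@cstar_triple R univ_alg) univ_map.
Proof.
split=> [a x y|x y z]; apply: univ_ext => j; have [linf homf] := tf_hom j.
  by rewrite univ_ev_linear !univ_ev_map linf.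
by rewrite (star_hom_triple (univ_ev_star_hom j)).2 !univ_ev_map homf.
Qed.

(** Induction on terms places every term in any C*-subalgebra containing the image of Z, and the
    terms are dense. *)
Lemma univ_generated : cstar_generated (range univ_map) = [set: univ_alg].
Proof.
apply/seteqP; split=> // x _ S [[S0 Slin Smul Sstar clS] ZS].
have Sterm t : S (univ_emb t).
  elim: t => [z||t St u Su|a t St|t St u Su|t St].
  - by apply: ZS; exists z.
  - exact: S0.
  - rewrite (_ : univ_emb _ = 1 *: univ_emb t + univ_emb u); first exact: Slin.
    by apply: univ_ext => j; rewrite univ_ev_linear !univ_ev_emb scale1r.
  - rewrite (_ : univ_emb _ = a *: univ_emb t + 0); first exact: Slin.
    by apply: univ_ext => j; rewrite univ_ev_linear !univ_ev_emb/= addr0.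
  - rewrite (_ : univ_emb _ = cmul (univ_emb t) (univ_emb u)); first exact: Smul.
    by apply: univ_ext => j; rewrite univ_ev_mul !univ_ev_emb.
  - rewrite (_ : univ_emb _ = cstar (univ_emb t)); first exact: Sstar.
    by apply: univ_ext => j; rewrite univ_ev_star !univ_ev_emb.
apply: closed_approx => // e e0.
have [t xt] := cpl_dense x (divr_gt0 e0 (ltr0n R 2)).
exists (univ_emb t) => //; rewrite (le_lt_trans xt)//.
by rewrite ltr_pdivrMr// ltr_pMr// ltr1n.
Qed.

End UniversalAlgebra.

(** * Riesz representation and adjoints *)

Section ComplexParts.
Context {R : realType}.
Implicit Types (a c : R[i]).

Lemma ReD a c : complex.Re (a + c) = complex.Re a + complex.Re c.
Proof. by case: a c => ? ? []. Qed.

Lemma ReN a : complex.Re (- a) = - complex.Re a.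
Proof. by case: a. Qed.

Lemma Re_conjc a : complex.Re (Num.conj a) = complex.Re a.
Proof. by case: a. Qed.

Lemma mul_conj_cnorm c : Num.conj c * c = (cnorm c ^+ 2)%:C.
Proof. by rewrite rmorphXn/= -cnormE mulrC -normCK. Qed.

Lemma cnorm_eq0 c : cnorm c = 0 -> c = 0.
Proof. by move=> c0; apply/normr0_eq0; rewrite cnormE c0. Qed.

(** The discriminant argument behind three later estimates: Cauchy-Schwarz in a Hilbert space,
    Cauchy-Schwarz in a direct sum, and the error of an almost minimiser in [riesz]. Only multiples
    of the conjugate of c are tested. *)
Lemma psd_discriminant (n m : R) (c : R[i]) : 0 <= n -> 0 <= m ->
  (forall a : R[i], 0 <= n + 2 * complex.Re (a * c) + cnorm a ^+ 2 * m) ->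
  cnorm c ^+ 2 <= n * m.
Proof.
move=> n0 m0 H; set k := cnorm c ^+ 2; have k0 : 0 <= k by rewrite sqr_ge0.
have {}H s : 0 <= n - 2 * s * k + s ^+ 2 * k * m.
  have := H (- s%:C * Num.conj c).
  rewrite -[_ * _ * c]mulrA mul_conj_cnorm mulNr -rmorphM ReN/= mulrN mulrA.
  by rewrite cnormM cnormN cnorm_real cnorm_conj exprMn real_normK ?num_real.
(* If m = 0 the expression is affine in s, and s = (n + 1) / (2 k) would give -1 unless k = 0.
   Otherwise s = 1 / m is the minimum. *)
have [m00|m1] := eqVneq m 0.
  rewrite leNgt; apply/negP; rewrite m00 mulr0 => kp.
  have := H ((n + 1) / (2 * k)); rewrite m00 mulr0 addr0.
  have -> : 2 * ((n + 1) / (2 * k)) * k = n + 1 by field; rewrite gt_eqF.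
  by rewrite opprD addrA subrr add0r oppr_ge0 ler10.
have mp : 0 < m by rewrite lt_neqAle eq_sym m1.
have := H m^-1; have -> : n - 2 * m^-1 * k + m^-1 ^+ 2 * k * m = n - k / m by field.
by rewrite subr_ge0 ler_pdivrMr.
Qed.

End ComplexParts.

Section Inner.
Context {R : realType} {H : hilbertType R}.
Implicit Types (x y z u v w : H) (a : R[i]).

Lemma innerDl x y z : inner (x + y) z = inner x z + inner y z.
Proof. exact: linearDl. Qed.

Lemma innerZl a x y : inner (a *: x) y = a * inner x y.
Proof. exact: linearZl_LR. Qed.

Lemma innerC x y : inner x y = Num.conj (inner y x).
Proof. by rewrite hermC expr0 mul1r. Qed.

Lemma innerDr x y z : inner x (y + z) = inner x y + inner x z.
Proof. exact: linearDr. Qed.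

Lemma innerBr x y z : inner x (y - z) = inner x y - inner x z.
Proof. exact: linearBr. Qed.

Lemma innerZr a x y : inner x (a *: y) = Num.conj a * inner x y.
Proof. exact: linearZr_LR. Qed.

Lemma inner_self x : inner x x = (rnorm x ^+ 2)%:C.
Proof. by rewrite inner_norm rnormE rmorphXn. Qed.

Lemma rnormD_sqr x y :
  rnorm (x + y) ^+ 2 = rnorm x ^+ 2 + rnorm y ^+ 2 + 2 * complex.Re (inner x y).
Proof.
have nE z : rnorm z ^+ 2 = complex.Re (inner z z) by rewrite inner_self.
by rewrite !nE innerDl !innerDr !ReD (innerC y x) Re_conjc; ring.
Qed.

Lemma cnorm_inner_le x y : cnorm (inner x y) <= rnorm x * rnorm y.
Proof.
rewrite -ler_sqr ?nnegrE ?mulr_ge0 ?rnorm_ge0 ?cnorm_ge0// exprMn.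
rewrite mulrC psd_discriminant ?sqr_ge0// => a.
rewrite -exprMn -rnormZ -innerZl; have := sqr_ge0 (rnorm (y + a *: x)).
by rewrite rnormD_sqr (innerC y) Re_conjc addrAC.
Qed.

Lemma inner_ext x y : (forall u, inner u x = inner u y) -> x = y.
Proof.
move=> xy; apply/eqP; rewrite -subr_eq0; apply/eqP/rnorm_eq0/eqP.
have := inner_self (x - y); rewrite innerBr xy subrr => /esym/complexI/eqP.
by rewrite sqrf_eq0.
Qed.

(* The representing vector minimises [|w|^2 - 2 Re l(w)]; an almost minimiser
   represents [l] up to a small functional, so no parallelogram law is needed. *)
Lemma riesz (l : H -> R[i]) (M : R) :
  (forall a x y, l (a *: x + y) = a * l x + l y) ->
  (forall x, cnorm (l x) <= M * rnorm x) ->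
  exists w, forall u, l u = inner u w.
Proof.
move=> linl lM.
pose q w := rnorm w ^+ 2 - 2 * complex.Re (l w).
have qM w : - (M ^+ 2) <= q w.
  have h : complex.Re (l w) <= M * rnorm w := le_trans (Re_le_cnorm _) (lM w).
  rewrite /q lerBrDr; move: h; set r := complex.Re _; set s := rnorm w => h.
  have := sqr_ge0 (M - s); rewrite sqrrB -mulr_natr; lra.
have qinf : has_inf (range q).
  by split; [exists (q 0), 0|exists (- (M ^+ 2)) => _ [w _ <-]].
set m := inf (range q).
have qm w : m <= q w by apply: ge_inf; [case: qinf|exists w].
have qD w a u : q (w + a *: u) =
    q w + 2 * complex.Re (a * (inner u w - l u)) + cnorm a ^+ 2 * rnorm u ^+ 2.
  rewrite /q rnormD_sqr addrC [w + _]addrC linl ReD (innerC w) Re_conjc innerZl.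
  rewrite rnormZ exprMn mulrBr ReD ReN; ring.
have e0 n : 0 < (n.+1%:R^-1 : R) by rewrite invr_gt0.
have /choice[w wq] n : exists v, q v < m + n.+1%:R^-1 ^+ 2.
  have [_ [v _ <-] vq] := inf_adherent (exprn_gt0 2 (e0 n)) qinf.
  by exists v.
(* As [w n] is within (n+1)^-2 of the infimum, the quadratic expression in a given by [qD] cannot
   drop by more than that; its discriminant bounds the linear coefficient. *)
have wl n u : cnorm (inner u (w n) - l u) <= n.+1%:R^-1 * rnorm u.
  rewrite -ler_sqr ?nnegrE ?mulr_ge0 ?rnorm_ge0 ?cnorm_ge0 ?invr_ge0// exprMn.
  rewrite psd_discriminant ?sqr_ge0// => a.
  have := qm (w n + a *: u); rewrite qD; have := wq n.
  by move: (_ ^+ 2) => r; lra.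
(* For d = w n - w k, |d|^2 is the difference of the errors of [w n] and [w k] at d; both are
   controlled by [wl], and one factor |d| cancels. *)
have ww n k : rnorm (w n - w k) <= n.+1%:R^-1 + k.+1%:R^-1.
  have [->|d0] := eqVneq (rnorm (w n - w k)) 0; first by rewrite addr_ge0// ltW.
  set d := w n - w k in d0 *.
  have dp : 0 < rnorm d by rewrite lt_neqAle eq_sym d0 rnorm_ge0.
  rewrite -(ler_pM2r dp) -expr2 mulrDl.
  have -> : rnorm d ^+ 2 = cnorm (inner d d).
    by rewrite inner_self cnorm_real ger0_norm// sqr_ge0.
  have -> : inner d d = (inner d (w n) - l d) - (inner d (w k) - l d).
    by rewrite {2}/d innerBr opprB addrA subrK.
  by rewrite (le_trans (cnormD _ _))// cnormN lerD.
have wc : cauchy_seq w.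
  move=> e ep; have [N HN] := eventually_invS_lt (divr_gt0 ep (ltr0n _ 2)).
  exists N => n k /HN hn /HN hk; rewrite (le_lt_trans (ww _ _))//.
  by rewrite [e]splitr ltrD.
have [v wv] := cauchy_seq_lim wc.
exists v => u; apply/eqP; rewrite -subr_eq0; apply/eqP/cnorm_eq0/eqP.
rewrite eq_le cnorm_ge0 andbT; apply/ler_addgt0Pr => e ep; rewrite add0r.
have c0 : 0 < rnorm u + 1 by rewrite ltr_wpDl ?rnorm_ge0.
have d0 : 0 < e / 2 / (rnorm u + 1) by rewrite !divr_gt0.
have [N1 H1] := eventually_invS_lt d0; have [N2 H2] := wv _ d0.
have {}H1 := H1 _ (leq_maxl N1 N2); have {}H2 := H2 _ (leq_maxr N1 N2).
set k := maxn N1 N2 in H1 H2.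
have -> : l u - inner u v = inner u (w k - v) - (inner u (w k) - l u).
  by rewrite innerBr; ring.
rewrite (le_trans (cnormD _ _))// cnormN [e]splitr lerD//.
  rewrite (le_trans (cnorm_inner_le _ _))//.
  move: H2; rewrite ltr_pdivlMr// => /ltW; apply: le_trans.
  by rewrite mulrC ler_wpM2l ?rnorm_ge0// lerDl.
rewrite (le_trans (wl _ _))//.
move: H1; rewrite ltr_pdivlMr// => /ltW; apply: le_trans.
by rewrite ler_wpM2l ?lerDl// ltW.
Qed.

(** Riesz for the functionals u -> inner (f u) v produces an adjoint, so the default value in
    [adjoint] is not taken. *)
Lemma adjointP (f : H -> H) : bounded_op f ->
  forall u v, inner (f u) v = inner u (adjoint f v).
Proof.
move=> /bounded_op_rnorm[linf [M M0 fM]].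
suff [g fg] : exists g : H -> H, forall u v, inner (f u) v = inner u (g v).
  by rewrite /adjoint; case: xgetP => [h -> //|/(_ g)].
suff /choice[g fg] : forall v, exists w, forall u, inner (f u) v = inner u w.
  by exists g => u v.
move=> v; apply: (@riesz _ (M * rnorm v)) => [a x y|x].
  by rewrite linf innerDl innerZl.
by rewrite (le_trans (cnorm_inner_le _ _))// mulrAC ler_wpM2r ?rnorm_ge0.
Qed.

Lemma rnorm_op_bounded (f : H -> H) (M : R) : linear f ->
  (forall x, rnorm (f x) <= M * rnorm x) -> bounded_op f.
Proof.
by move=> linf fM; split=> //; exists M%:C => x; rewrite !rnormE -rmorphM lecR.
Qed.

Lemma adjoint_rnorm_le (f : H -> H) (M : R) : bounded_op f -> 0 <= M ->
  (forall x, rnorm (f x) <= M * rnorm x) ->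
  forall x, rnorm (adjoint f x) <= M * rnorm x.
Proof.
move=> fb M0 fM x; set y := adjoint f x.
have [->|y0] := eqVneq (rnorm y) 0; first by rewrite mulr_ge0 ?rnorm_ge0.
have yp : 0 < rnorm y by rewrite lt_neqAle eq_sym y0 rnorm_ge0.
rewrite -(ler_pM2r yp) -expr2.
have -> : rnorm y ^+ 2 = cnorm (inner (f y) x).
  by rewrite adjointP// inner_self cnorm_real ger0_norm// sqr_ge0.
by rewrite (le_trans (cnorm_inner_le _ _))// mulrAC ler_wpM2r ?rnorm_ge0.
Qed.

Lemma adjoint_bounded (f : H -> H) : bounded_op f -> bounded_op (adjoint f).
Proof.
move=> fb; have [_ [M M0 fM]] := bounded_op_rnorm fb.
apply: (@rnorm_op_bounded _ M); last exact: adjoint_rnorm_le.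
move=> a x y; apply: inner_ext => u.
by rewrite innerDr innerZr -!adjointP// innerDr innerZr.
Qed.

End Inner.

(** * The C*-algebra of bounded operators *)

(** Bounded operators need a type of their own in order to carry a norm and the structure of a
    C*-algebra. *)
Definition bop (R : realType) (H : hilbertType R) : Type :=
  {f : H -> H | bounded_op f}.

Section BoundedOperatorAlgebra.
Context {R : realType} {H : hilbertType R}.
Local Notation B := (bop H).
Implicit Types f g : B.

Definition bop_fun f : H -> H := proj1_sig f.

Lemma bop_bounded f : bounded_op (bop_fun f).
Proof. exact: proj2_sig. Qed.

Definition bop_of (f : H -> H) (fb : bounded_op f) : B := exist _ f fb.

Lemma bop_ext f g : (forall x, bop_fun f x = bop_fun g x) -> f = g.
Proof.
case: f g => [f fb] [g gb] /= fg; have E : f = g by apply/funext.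
by move: fb gb; rewrite E => fb gb; congr exist.
Qed.

Lemma bop_linear f a x y : bop_fun f (a *: x + y) = a *: bop_fun f x + bop_fun f y.
Proof. by have [linf _] := bop_bounded f; rewrite linf. Qed.

HB.instance Definition _ := gen_eqMixin B.
HB.instance Definition _ := gen_choiceMixin B.

Lemma bop_zero_bounded : bounded_op (fun _ : H => 0 : H).
Proof.
apply: (@rnorm_op_bounded _ _ _ 0) => [a x y|x]; first by rewrite scaler0 addr0.
by rewrite rnorm0 mul0r.
Qed.

Lemma bop_add_bounded f g : bounded_op (fun x => bop_fun f x + bop_fun g x).
Proof.
have [_ [M M0 fM]] := bounded_op_rnorm (bop_bounded f).
have [_ [K K0 gK]] := bounded_op_rnorm (bop_bounded g).
apply: (@rnorm_op_bounded _ _ _ (M + K)) => [a x y|x].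
  by rewrite !bop_linear scalerDr addrACA.
by rewrite (le_trans (rnormD _ _))// mulrDl lerD.
Qed.

Lemma bop_scale_bounded (a : R[i]) f : bounded_op (fun x => a *: bop_fun f x).
Proof.
have [_ [M M0 fM]] := bounded_op_rnorm (bop_bounded f).
apply: (@rnorm_op_bounded _ _ _ (cnorm a * M)) => [b x y|x].
  by rewrite bop_linear scalerDr !scalerA mulrC.
by rewrite rnormZ -mulrA ler_wpM2l ?cnorm_ge0.
Qed.

Lemma bop_comp_bounded f g : bounded_op (bop_fun f \o bop_fun g).
Proof.
have [_ [M M0 fM]] := bounded_op_rnorm (bop_bounded f).
have [_ [K K0 gK]] := bounded_op_rnorm (bop_bounded g).
apply: (@rnorm_op_bounded _ _ _ (M * K)) => [a x y|x /=].
  by rewrite /= !bop_linear.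
by rewrite (le_trans (fM _))// -mulrA ler_wpM2l.
Qed.

Definition bop_zero : B := bop_of bop_zero_bounded.
Definition bop_add f g : B := bop_of (bop_add_bounded f g).
Definition bop_scale a f : B := bop_of (bop_scale_bounded a f).
Definition bop_mul f g : B := bop_of (bop_comp_bounded f g).
Definition bop_star f : B := bop_of (adjoint_bounded (bop_bounded f)).

Lemma bop_addA : associative bop_add.
Proof. by move=> f g h; apply: bop_ext => x /=; rewrite addrA. Qed.

Lemma bop_addC : commutative bop_add.
Proof. by move=> f g; apply: bop_ext => x /=; rewrite addrC. Qed.

Lemma bop_add0 : left_id bop_zero bop_add.
Proof. by move=> f; apply: bop_ext => x /=; rewrite add0r. Qed.

Lemma bop_addN : left_inverse bop_zero (bop_scale (-1)) bop_add.
Proof. by move=> f; apply: bop_ext => x /=; rewrite scaleN1r addNr. Qed.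

HB.instance Definition _ := GRing.isZmodule.Build B bop_addA bop_addC bop_add0 bop_addN.

Lemma bop_scalerA a b f : bop_scale a (bop_scale b f) = bop_scale (a * b) f.
Proof. by apply: bop_ext => x /=; rewrite scalerA. Qed.

Lemma bop_scale1r : left_id 1 bop_scale.
Proof. by move=> f; apply: bop_ext => x /=; rewrite scale1r. Qed.

Lemma bop_scalerDr : right_distributive bop_scale +%R.
Proof. by move=> a f g; apply: bop_ext => x /=; rewrite scalerDr. Qed.

Lemma bop_scalerDl f : {morph bop_scale^~ f : a b / a + b}.
Proof. by move=> a b; apply: bop_ext => x /=; rewrite scalerDl. Qed.

HB.instance Definition _ := GRing.Zmodule_isLmodule.Build R[i] B
  bop_scalerA bop_scale1r bop_scalerDr bop_scalerDl.

Lemma bopD f g x : bop_fun (f + g) x = bop_fun f x + bop_fun g x.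
Proof. by []. Qed.

Lemma bopZ a f x : bop_fun (a *: f) x = a *: bop_fun f x.
Proof. by []. Qed.

Lemma bopB f g x : bop_fun (f - g) x = bop_fun f x - bop_fun g x.
Proof. by rewrite bopD -scaleN1r bopZ scaleN1r. Qed.

Definition op_rnorm f : R :=
  sup [set r | exists2 x, rnorm x <= 1 & r = rnorm (bop_fun f x)].

Lemma op_rnorm_has_sup f :
  has_sup [set r | exists2 x, rnorm x <= 1 & r = rnorm (bop_fun f x)].
Proof.
split; first by exists (rnorm (bop_fun f 0)), 0 => //; rewrite rnorm0.
have [_ [M M0 fM]] := bounded_op_rnorm (bop_bounded f).
exists M => _ [x x1 ->]; rewrite (le_trans (fM x))//.
by rewrite ler_piMr.
Qed.

Lemma op_rnorm_ge0 f : 0 <= op_rnorm f.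
Proof.
rewrite (le_trans (rnorm_ge0 (bop_fun f 0)))//.
by apply: (sup_upper_bound (op_rnorm_has_sup f)); exists 0 => //; rewrite rnorm0.
Qed.

Lemma op_rnorm_ub f x : rnorm (bop_fun f x) <= op_rnorm f * rnorm x.
Proof.
have [x0|x0] := eqVneq (rnorm x) 0.
  have := bop_linear f 0 x 0; rewrite (rnorm_eq0 x0) scaler0 addr0 scale0r add0r => _.
  have [_ [M M0 fM]] := bounded_op_rnorm (bop_bounded f).
  by rewrite (le_trans (fM _))// rnorm0 !mulr0.
have xp : 0 < rnorm x by rewrite lt_neqAle eq_sym x0 rnorm_ge0.
have -> : bop_fun f x = (rnorm x)%:C *: bop_fun f ((rnorm x)%:C^-1 *: x).
  have := bop_linear f (rnorm x)%:C ((rnorm x)%:C^-1 *: x) 0.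
  have f0 : bop_fun f 0 = 0.
    by have := bop_linear f (-1) 0 0; rewrite scaler0 addr0 scaleN1r addNr.
  rewrite f0 !addr0 scalerA mulfV ?scale1r//.
  by rewrite -cnorm_gt0 cnorm_real normr_gt0.
rewrite rnormZ cnorm_real (gtr0_norm xp) mulrC ler_pM2r//.
apply: (sup_upper_bound (op_rnorm_has_sup f)).
exists ((rnorm x)%:C^-1 *: x) => //.
by rewrite rnormZ cnormV cnorm_real (gtr0_norm xp) mulVf.
Qed.

Lemma op_rnorm_le f (c : R) : 0 <= c ->
  (forall x, rnorm (bop_fun f x) <= c * rnorm x) -> op_rnorm f <= c.
Proof.
move=> c0 fc; apply: ge_sup; first by case: (op_rnorm_has_sup f).
by move=> _ [x x1 ->]; rewrite (le_trans (fc x))// ler_piMr.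
Qed.

Definition op_norm f : R[i] := (op_rnorm f)%:C.

Lemma op_normD f g : op_norm (f + g) <= op_norm f + op_norm g.
Proof.
rewrite -rmorphD/= lecR op_rnorm_le ?addr_ge0 ?op_rnorm_ge0// => x.
by rewrite bopD (le_trans (rnormD _ _))// mulrDl lerD ?op_rnorm_ub.
Qed.

Lemma op_rnormZ_le a f : op_rnorm (a *: f) <= cnorm a * op_rnorm f.
Proof.
apply: op_rnorm_le => [|x]; first by rewrite mulr_ge0 ?cnorm_ge0 ?op_rnorm_ge0.
by rewrite bopZ rnormZ -mulrA ler_wpM2l ?cnorm_ge0 ?op_rnorm_ub.
Qed.

Lemma op_normZ a f : op_norm (a *: f) = `|a| * op_norm f.
Proof.
rewrite cnormE -rmorphM/=; congr (_ %:C); apply/eqP; rewrite eq_le op_rnormZ_le/=.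
have [->|a0] := eqVneq a 0; first by rewrite cnorm0 mul0r op_rnorm_ge0.
have := op_rnormZ_le a^-1 (a *: f).
by rewrite scalerA mulVf// scale1r cnormV mulrC ler_pdivlMr ?cnorm_gt0// mulrC.
Qed.

Lemma op_norm0_eq0 f : op_norm f = 0 -> f = 0.
Proof.
move=> /complexI f0; apply: bop_ext => x; apply: rnorm_eq0.
by apply/eqP; rewrite eq_le rnorm_ge0 andbT (le_trans (op_rnorm_ub f x))// f0 mul0r.
Qed.

HB.instance Definition _ := Lmodule_isNormed.Build R[i] B op_normD op_normZ op_norm0_eq0.

Lemma rnorm_bopE f : rnorm f = op_rnorm f.
Proof. by rewrite rnorm.unlock. Qed.

Lemma rnorm_bop f x : rnorm (bop_fun f x) <= rnorm f * rnorm x.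
Proof. by rewrite rnorm_bopE; apply: op_rnorm_ub. Qed.

Lemma rnorm_bop_le f (c : R) : 0 <= c ->
  (forall x, rnorm (bop_fun f x) <= c * rnorm x) -> rnorm f <= c.
Proof. by rewrite rnorm_bopE; apply: op_rnorm_le. Qed.

Lemma bop_seq_complete (f : nat -> B) : cauchy_seq f -> exists g, seq_lim f g.
Proof.
move=> fc.
have fxc x : cauchy_seq (fun n => bop_fun (f n) x).
  have c0 : 0 < rnorm x + 1 by rewrite ltr_wpDl ?rnorm_ge0.
  move=> e e0; have [N HN] := fc _ (divr_gt0 e0 c0).
  exists N => m n /HN h /h; rewrite ltr_pdivlMr// => {}h.
  rewrite -bopB (le_lt_trans (rnorm_bop _ _))// (le_lt_trans _ h)//.
  by rewrite ler_wpM2l ?rnorm_ge0// lerDl.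
have /choice[g fg] x := cauchy_seq_lim (fxc x).
have near (e : R) : 0 < e -> exists N, forall n, (N <= n)%N ->
    forall x, rnorm (bop_fun (f n) x - g x) <= e * rnorm x.
  move=> e0; have [N HN] := fc _ e0; exists N => n Nn x.
  apply: (@seq_lim_norm_le _ _ (fun k => bop_fun (f n) x - bop_fun (f (N + k)%N) x)).
    move=> d /(fg x)[N' H']; exists N' => k Nk.
    rewrite opprB addrC addrA subrK rnormB; apply: H'.
    by rewrite (leq_trans Nk)// leq_addl.
  move=> k; rewrite -bopB (le_trans (rnorm_bop _ _))// ler_wpM2r ?rnorm_ge0//.
  by rewrite ltW// HN// leq_addr.
have ling : linear g.
  move=> a x y; apply: (seq_lim_uniq (fg _)).
  rewrite (_ : (fun n => _) = (fun n => a *: bop_fun (f n) x + bop_fun (f n) y)).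
    by apply: seq_limD => //; apply: seq_limZ.
  by apply/funext => n; rewrite bop_linear.
have gb : bounded_op g.
  have [N HN] := near 1 ltr01.
  apply: (@rnorm_op_bounded _ _ _ (1 + rnorm (f N))) => // x.
  rewrite mulrDl mul1r addrC (le_trans (rnorm_distl _ (bop_fun (f N) x)))//.
  by rewrite lerD ?rnorm_bop// rnormB -[leRHS]mul1r HN.
exists (bop_of gb) => e e0; have e2 : 0 < e / 2 by rewrite divr_gt0.
have [N HN] := near _ e2; exists N => n Nn.
apply: (@le_lt_trans _ _ (e / 2)); last by rewrite ltr_pdivrMr// ltr_pMr// ltr1n.
by apply: rnorm_bop_le => [|x]; [exact: ltW|rewrite bopB; apply: HN].
Qed.

HB.instance Definition _ := Uniform_isComplete.Build B (seq_complete bop_seq_complete).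

Lemma bop_starP f u v : inner (bop_fun f u) v = inner u (bop_fun (bop_star f) v).
Proof. exact/adjointP/bop_bounded. Qed.

Lemma bop_star_unique f g :
  (forall u v, inner (bop_fun f u) v = inner u (bop_fun g v)) -> bop_star f = g.
Proof.
move=> fg; apply: bop_ext => x; apply: inner_ext => u.
by rewrite -bop_starP.
Qed.

Lemma bop_mulA : associative bop_mul.
Proof. by move=> f g h; apply: bop_ext. Qed.

Lemma bop_mul_linearl g : linear (bop_mul^~ g).
Proof. by move=> a f h; apply: bop_ext. Qed.

Lemma bop_mul_linearr g : linear (bop_mul g).
Proof. by move=> a f h; apply: bop_ext => x /=; rewrite bop_linear. Qed.

Lemma bop_star_antilinear (a : R[i]) f g :
  bop_star (a *: f + g) = Num.conj a *: bop_star f + bop_star g.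
Proof.
apply: bop_star_unique => u v.
by rewrite !bopD !bopZ innerDl innerZl innerDr innerZr conjCK -!bop_starP.
Qed.

Lemma bop_starK : involutive bop_star.
Proof.
by move=> f; apply: bop_star_unique => u v; rewrite innerC -bop_starP -innerC.
Qed.

Lemma bop_starM f g : bop_star (bop_mul f g) = bop_mul (bop_star g) (bop_star f).
Proof. by apply: bop_star_unique => u v /=; rewrite -!bop_starP. Qed.

Lemma bop_mul_norm f g : `|bop_mul f g| <= `|f| * `|g|.
Proof.
rewrite !rnormE -rmorphM lecR rnorm_bop_le ?mulr_ge0 ?rnorm_ge0// => x.
rewrite (le_trans (rnorm_bop f _))// -mulrA ler_wpM2l ?rnorm_ge0//.
exact: rnorm_bop.
Qed.

Lemma bop_star_norm f : `|bop_mul (bop_star f) f| = `|f| ^+ 2.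
Proof.
rewrite rnormE [in RHS]rnormE -rmorphXn/=; congr (_ %:C).
have star_le : rnorm (bop_star f) <= rnorm f.
  apply: rnorm_bop_le => [|x]; first exact: rnorm_ge0.
  apply: adjoint_rnorm_le; [exact: bop_bounded|exact: rnorm_ge0|exact: rnorm_bop].
apply/eqP; rewrite eq_le; apply/andP; split.
  have := bop_mul_norm (bop_star f) f; rewrite !rnormE -rmorphM lecR => /le_trans; apply.
  by rewrite expr2 ler_wpM2r ?rnorm_ge0.
set g := bop_mul _ _.
rewrite -[leRHS]sqr_sqrtr ?rnorm_ge0// ler_sqr ?nnegrE ?rnorm_ge0 ?sqrtr_ge0//.
apply: rnorm_bop_le => [|x]; first exact: sqrtr_ge0.
rewrite -ler_sqr ?nnegrE ?mulr_ge0 ?rnorm_ge0 ?sqrtr_ge0// exprMn sqr_sqrtr ?rnorm_ge0//.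
have -> : rnorm (bop_fun f x) ^+ 2 = cnorm (inner x (bop_fun g x)).
  by rewrite -[bop_fun g x]/(bop_fun (bop_star f) (bop_fun f x)) -bop_starP
    inner_self cnorm_real ger0_norm// sqr_ge0.
rewrite (le_trans (cnorm_inner_le _ _))// mulrC expr2 mulrA ler_wpM2r ?rnorm_ge0//.
exact: rnorm_bop.
Qed.

HB.instance Definition _ := CompleteNormedModule_isCStarAlgebra.Build R B
  bop_mulA bop_mul_linearl bop_mul_linearr bop_star_antilinear bop_starK
  bop_starM bop_mul_norm bop_star_norm.

(** Holds by computation, [cstar] on [bop H] being [adjoint] and [cmul] composition; statements
    about TROs are thus transported into a C*-algebra. *)
Lemma bop_ternary f g h :
  bop_fun (cmul (cmul f (cstar g)) h) = ternary (bop_fun f) (bop_fun g) (bop_fun h).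
Proof. by []. Qed.

Lemma bop_triple f g h :
  bop_fun (cstar_triple f g h) = tro_triple (bop_fun f) (bop_fun g) (bop_fun h).
Proof. by []. Qed.

End BoundedOperatorAlgebra.

(** * Unconditional sums *)

Section UnconditionalSums.
Context {R : realType} {I : eqType}.
Implicit Types (f g : I -> R[i]) (s : seq I).

(** Convergence along the finite subsets of I, encoded as duplicate-free lists; I has neither an
    order nor a cardinality bound. *)
Definition has_usum f (c : R[i]) : Prop :=
  forall e : R, 0 < e -> exists s0, forall s, uniq s -> {subset s0 <= s} ->
    cnorm (\sum_(i <- s) f i - c) < e.

Lemma has_usum_unique f c d : has_usum f c -> has_usum f d -> c = d.
Proof.
move=> fc fd; apply/eqP; rewrite -subr_eq0; apply/eqP/cnorm_eq0/eqP.
rewrite eq_le cnorm_ge0 andbT; apply/ler_addgt0Pr => e e0; rewrite add0r.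
have [s1 H1] := fc _ (divr_gt0 e0 (ltr0n _ 2)).
have [s2 H2] := fd _ (divr_gt0 e0 (ltr0n _ 2)).
pose s := undup (s1 ++ s2).
have {}H1 : cnorm (\sum_(i <- s) f i - c) < e / 2.
  by apply: H1 => [|i si]; rewrite ?undup_uniq// mem_undup mem_cat si.
have {}H2 : cnorm (\sum_(i <- s) f i - d) < e / 2.
  by apply: H2 => [|i si]; rewrite ?undup_uniq// mem_undup mem_cat si orbT.
have -> : c - d = (\sum_(i <- s) f i - d) - (\sum_(i <- s) f i - c) by ring.
by rewrite (le_trans (cnormD _ _))// cnormN [e]splitr lerD ?ltW.
Qed.

Lemma has_usum_linear a f g c d : has_usum f c -> has_usum g d ->
  has_usum (fun i => a * f i + g i) (a * c + d).
Proof.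
move=> fc gd e e0.
have a0 : 0 < cnorm a + 1 by rewrite ltr_wpDl ?cnorm_ge0.
have [s1 H1] := fc _ (divr_gt0 (divr_gt0 e0 (ltr0n _ 2)) a0).
have [s2 H2] := gd _ (divr_gt0 e0 (ltr0n _ 2)).
exists (s1 ++ s2) => s us sub.
have {}H1 : cnorm (\sum_(i <- s) f i - c) < e / 2 / (cnorm a + 1).
  by apply: H1 => // i si; apply: sub; rewrite mem_cat si.
have {}H2 : cnorm (\sum_(i <- s) g i - d) < e / 2.
  by apply: H2 => // i si; apply: sub; rewrite mem_cat si orbT.
rewrite big_split -mulr_sumr/= opprD addrACA -mulrBr.
rewrite (le_lt_trans (cnormD _ _))// [e]splitr ltrD// cnormM.
move: H1; rewrite ltr_pdivlMr//; apply: le_lt_trans.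
by rewrite mulrC ler_wpM2l ?cnorm_ge0// lerDl.
Qed.

Lemma has_usum_conj f c : has_usum f c -> has_usum (fun i => Num.conj (f i)) (Num.conj c).
Proof.
move=> fc e /fc[s0 H]; exists s0 => s us /(H s us).
by rewrite -rmorph_sum -rmorphB cnorm_conj.
Qed.

Lemma has_usum_nonneg (f : I -> R) (M : R) : (forall i, 0 <= f i) ->
  (forall s, uniq s -> \sum_(i <- s) f i <= M) ->
  exists c : R, [/\ has_usum (fun i => (f i)%:C) c%:C, c <= M &
    forall s, uniq s -> \sum_(i <- s) f i <= c].
Proof.
move=> f0 fM; pose S := [set r | exists2 s, uniq s & r = \sum_(i <- s) f i].
have Ssup : has_sup S.
  split; first by exists 0, [::] => //; rewrite big_nil.
  by exists M => _ [s us ->]; apply: fM.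
have ub s : uniq s -> \sum_(i <- s) f i <= sup S.
  by move=> us; apply: sup_upper_bound => //; exists s.
exists (sup S); split=> //; last first.
  by apply: ge_sup; [case: Ssup|move=> _ [s us ->]; apply: fM].
move=> e e0; have [_ [s0 us0 ->] H] := sup_adherent e0 Ssup.
exists s0 => s us sub; rewrite -rmorph_sum -rmorphB cnorm_real distrC.
rewrite ger0_norm ?subr_ge0 ?ub//.
suff : \sum_(i <- s0) f i <= \sum_(i <- s) f i by move: H; lra.
have /(perm_big _)-> : perm_eq s (s0 ++ [seq i <- s | i \notin s0]).
  apply: uniq_perm => //.
    rewrite cat_uniq us0 filter_uniq// andbT; apply/hasPn => i.
    by rewrite mem_filter => /andP[].
  move=> i; rewrite mem_cat mem_filter; case: (boolP (i \in s0)) => //= /sub; exact.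
by rewrite big_cat/= lerDl sumr_ge0.
Qed.

(** Real and imaginary parts are summed separately, each part g as the difference of |g| + g and
    |g|. Both families are nonnegative with finite sums at most 2 M. *)
Lemma has_usum_exists f (M : R) :
  (forall s, uniq s -> \sum_(i <- s) cnorm (f i) <= M) -> exists c, has_usum f c.
Proof.
move=> fM.
have real (g : I -> R) : (forall i, `|g i| <= cnorm (f i)) ->
    exists c, has_usum (fun i => (g i)%:C) c.
  move=> gf.
  have pos (h : I -> R) : (forall i, 0 <= h i <= cnorm (f i) * 2) ->
      exists c, has_usum (fun i => (h i)%:C) c.
    move=> hf; have [|s us|c [hc _ _]] := @has_usum_nonneg h (M * 2).
    - by move=> i; case/andP: (hf i).
    - rewrite (@le_trans _ _ (\sum_(i <- s) cnorm (f i) * 2))//.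
        by apply: ler_sum => i _; case/andP: (hf i).
      by rewrite -mulr_suml ler_pM2r// fM.
    - by exists c%:C.
  have [|c1 H1] := pos (fun i => `|g i| + g i).
    move=> i; have gi := gf i; have h1 := ler_norm (g i); have h2 := ler_norm (- g i).
    by move: h2; rewrite normrN => h2; apply/andP; split; lra.
  have [|c2 H2] := pos (fun i => `|g i|).
    move=> i; rewrite normr_ge0/= (le_trans (gf i))// ler_peMr ?cnorm_ge0//.
    by rewrite ler1n.
  exists (-1 * c2 + c1); have := has_usum_linear (-1) H2 H1.
  by congr has_usum; apply/funext => i; rewrite rmorphD/= mulN1r addrA addNr add0r.
have [|c1 H1] := real (fun i => complex.Re (f i)).
  by move=> i; rewrite ler_norml Re_le_cnorm andbT lerNl -ReN -(cnormN (f i)) Re_le_cnorm.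
have [|c2 H2] := real (fun i => complex.Im (f i)).
  move=> i; have ImE a : complex.Im a = complex.Re (- 'i * a).
    by case: a => x y /=; rewrite oppr0 mul0r mulN1r sub0r opprK.
  rewrite ImE -[cnorm _]mul1r -cnorm_i -(cnormN 'i) -cnormM.
  by rewrite ler_norml Re_le_cnorm andbT lerNl -ReN -(cnormN (_ * _)) Re_le_cnorm.
exists ('i * c2 + c1); have := has_usum_linear 'i H2 H1.
by congr has_usum; apply/funext => i; rewrite addrC -complexE.
Qed.

End UnconditionalSums.

(** * Hilbert direct sums *)

Section DirectSum.
Context {R : realType} {I : eqType} (K : I -> hilbertType R).

Definition sq_bounded (x : forall i, K i) (M : R) : Prop :=
  forall s : seq I, uniq s -> \sum_(i <- s) rnorm (x i) ^+ 2 <= M.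

Definition dsum : Type := {x : forall i, K i | exists M, sq_bounded x M}.

Implicit Types x y z : dsum.

Definition dcoord x : forall i, K i := proj1_sig x.

Definition dsum_of (x : forall i, K i) (M : R) (xM : sq_bounded x M) : dsum :=
  exist _ x (ex_intro _ M xM).

Lemma dsum_ext x y : (forall i, dcoord x i = dcoord y i) -> x = y.
Proof.
case: x y => [x xM] [y yM] /= xy.
have E : x = y by apply: functional_extensionality_dep.
by move: xM yM; rewrite E => xM yM; congr exist.
Qed.

Lemma sq_rnormD (H : hilbertType R) (u v : H) :
  rnorm (u + v) ^+ 2 <= 2 * rnorm u ^+ 2 + 2 * rnorm v ^+ 2.
Proof.
apply: (@le_trans _ _ ((rnorm u + rnorm v) ^+ 2)).
  by rewrite ler_sqr ?nnegrE ?addr_ge0 ?rnorm_ge0// rnormD.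
rewrite -subr_ge0 (_ : _ - _ = (rnorm u - rnorm v) ^+ 2) ?sqr_ge0//; ring.
Qed.

Lemma dsum_zero_bounded : sq_bounded (fun i => 0 : K i) 0.
Proof. by move=> s us; rewrite big1// => i _; rewrite rnorm0 expr0n. Qed.

Lemma dsum_add_bounded x y : exists M, sq_bounded (fun i => dcoord x i + dcoord y i) M.
Proof.
have [[M xM] [N yN]] := (proj2_sig x, proj2_sig y).
exists (2 * M + 2 * N) => s us.
rewrite (le_trans (ler_sum _ (fun i _ => sq_rnormD _ _)))// big_split/= -!mulr_sumr.
by rewrite lerD// ler_pM2l// ?xM ?yN.
Qed.

Lemma dsum_scale_bounded (a : R[i]) x : exists M, sq_bounded (fun i => a *: dcoord x i) M.
Proof.
have [M xM] := proj2_sig x; exists (cnorm a ^+ 2 * M) => s us.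
under eq_bigr => i _ do rewrite rnormZ exprMn.
by rewrite -mulr_sumr ler_wpM2l ?sqr_ge0// xM.
Qed.

Definition dsum_zero : dsum := dsum_of dsum_zero_bounded.
Definition dsum_add x y : dsum := exist _ _ (dsum_add_bounded x y).
Definition dsum_scale a x : dsum := exist _ _ (dsum_scale_bounded a x).

HB.instance Definition _ := gen_eqMixin dsum.
HB.instance Definition _ := gen_choiceMixin dsum.

Lemma dsum_addA : associative dsum_add.
Proof. by move=> x y z; apply: dsum_ext => i /=; rewrite addrA. Qed.

Lemma dsum_addC : commutative dsum_add.
Proof. by move=> x y; apply: dsum_ext => i /=; rewrite addrC. Qed.

Lemma dsum_add0 : left_id dsum_zero dsum_add.
Proof. by move=> x; apply: dsum_ext => i /=; rewrite add0r. Qed.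

Lemma dsum_addN : left_inverse dsum_zero (dsum_scale (-1)) dsum_add.
Proof. by move=> x; apply: dsum_ext => i /=; rewrite scaleN1r addNr. Qed.

HB.instance Definition _ :=
  GRing.isZmodule.Build dsum dsum_addA dsum_addC dsum_add0 dsum_addN.

Lemma dsum_scalerA a b x : dsum_scale a (dsum_scale b x) = dsum_scale (a * b) x.
Proof. by apply: dsum_ext => i /=; rewrite scalerA. Qed.

Lemma dsum_scale1r : left_id 1 dsum_scale.
Proof. by move=> x; apply: dsum_ext => i /=; rewrite scale1r. Qed.

Lemma dsum_scalerDr : right_distributive dsum_scale +%R.
Proof. by move=> a x y; apply: dsum_ext => i /=; rewrite scalerDr. Qed.

Lemma dsum_scalerDl x : {morph dsum_scale^~ x : a b / a + b}.
Proof. by move=> a b; apply: dsum_ext => i /=; rewrite scalerDl. Qed.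

HB.instance Definition _ := GRing.Zmodule_isLmodule.Build R[i] dsum
  dsum_scalerA dsum_scale1r dsum_scalerDr dsum_scalerDl.

Lemma dcoordD x y i : dcoord (x + y) i = dcoord x i + dcoord y i.
Proof. by []. Qed.

Lemma dcoordZ a x i : dcoord (a *: x) i = a *: dcoord x i.
Proof. by []. Qed.

Lemma dcoordB x y i : dcoord (x - y) i = dcoord x i - dcoord y i.
Proof. by rewrite dcoordD -scaleN1r dcoordZ scaleN1r. Qed.

Definition dinner x y : R[i] :=
  xget 0 [set c | has_usum (fun i => inner (dcoord x i) (dcoord y i)) c].

Lemma dinnerP x y : has_usum (fun i => inner (dcoord x i) (dcoord y i)) (dinner x y).
Proof.
suff [c fc] : exists c, has_usum (fun i => inner (dcoord x i) (dcoord y i)) c.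
  by rewrite /dinner; case: xgetP => [d -> //|/(_ c)].
have [[M xM] [N yN]] := (proj2_sig x, proj2_sig y).
apply: (@has_usum_exists _ _ _ (M + N)) => s us.
rewrite (@le_trans _ _ (\sum_(i <- s) (rnorm (dcoord x i) ^+ 2 + rnorm (dcoord y i) ^+ 2)))//.
  apply: ler_sum => i _; rewrite (le_trans (cnorm_inner_le _ _))//.
  have := sqr_ge0 (rnorm (dcoord x i) - rnorm (dcoord y i)).
  have := sqr_ge0 (rnorm (dcoord x i) + rnorm (dcoord y i)).
  by move: (rnorm (dcoord x i)) (rnorm (dcoord y i)) => p q; nra.
by rewrite big_split lerD ?xM ?yN.
Qed.

Lemma dinnerE x y c :
  has_usum (fun i => inner (dcoord x i) (dcoord y i)) c -> dinner x y = c.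
Proof. exact/has_usum_unique/dinnerP. Qed.

Lemma dinner_linear a x y z : dinner (a *: x + y) z = a * dinner x z + dinner y z.
Proof.
apply: dinnerE; have := has_usum_linear a (dinnerP x z) (dinnerP y z).
by congr has_usum; apply/funext => i; rewrite dcoordD dcoordZ innerDl innerZl.
Qed.

Lemma dinnerC x y : dinner x y = Num.conj (dinner y x).
Proof.
apply: dinnerE; have := has_usum_conj (dinnerP y x).
by congr has_usum; apply/funext => i; rewrite -innerC.
Qed.

Definition dsum_rnorm x : R := Num.sqrt (complex.Re (dinner x x)).

Lemma dsum_rnormP x : [/\ dinner x x = (dsum_rnorm x ^+ 2)%:C,
  sq_bounded (dcoord x) (dsum_rnorm x ^+ 2) &
  forall M, sq_bounded (dcoord x) M -> dsum_rnorm x ^+ 2 <= M].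
Proof.
have sq0 i : 0 <= rnorm (dcoord x i) ^+ 2 by rewrite sqr_ge0.
have dE M : sq_bounded (dcoord x) M -> exists c : R,
    [/\ dinner x x = c%:C, c <= M & sq_bounded (dcoord x) c].
  move=> xM; have [c [hc cM cb]] := has_usum_nonneg sq0 xM.
  exists c; split=> //; apply: dinnerE; move: hc.
  by congr has_usum; apply/funext => i; rewrite inner_self.
have [M0 xM0] := proj2_sig x; have [c [cE _ cb]] := dE _ xM0.
have c0 : 0 <= c by have := cb [::] isT; rewrite big_nil.
have nE : dsum_rnorm x ^+ 2 = c by rewrite /dsum_rnorm cE sqr_sqrtr.
split; rewrite nE//.
by move=> M /dE[d [dE' dM _]]; have := cE; rewrite dE' => /complexI <-.
Qed.

Lemma dsum_rnorm_ge0 x : 0 <= dsum_rnorm x.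
Proof. exact: sqrtr_ge0. Qed.

Lemma dinner_self x : dinner x x = (dsum_rnorm x ^+ 2)%:C.
Proof. by case: (dsum_rnormP x). Qed.

Lemma dinnerDl x y z : dinner (x + y) z = dinner x z + dinner y z.
Proof. by have := dinner_linear 1 x y z; rewrite scale1r mul1r. Qed.

Lemma dinnerDr x y z : dinner x (y + z) = dinner x y + dinner x z.
Proof. by rewrite dinnerC dinnerDl rmorphD/= -!dinnerC. Qed.

Lemma dinner0l y : dinner 0 y = 0.
Proof. by apply: (addrI (dinner 0 y)); rewrite -dinnerDl !addr0. Qed.

Lemma dinnerZl a x y : dinner (a *: x) y = a * dinner x y.
Proof. by have := dinner_linear a x 0 y; rewrite dinner0l !addr0. Qed.

Lemma dinnerZr a x y : dinner x (a *: y) = Num.conj a * dinner x y.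
Proof. by rewrite dinnerC dinnerZl rmorphM/= -dinnerC. Qed.

Lemma dsum_rnormZ a x : dsum_rnorm (a *: x) = cnorm a * dsum_rnorm x.
Proof.
apply/eqP; rewrite -(@eqrXn2 _ 2) ?mulr_ge0 ?cnorm_ge0 ?dsum_rnorm_ge0//.
apply/eqP/complexI; rewrite -dinner_self dinnerZl dinnerZr mulrA (mulrC a).
by rewrite mul_conj_cnorm dinner_self -rmorphM exprMn.
Qed.

Lemma dsum_rnormD_sqr x y : dsum_rnorm (x + y) ^+ 2 =
  dsum_rnorm x ^+ 2 + dsum_rnorm y ^+ 2 + 2 * complex.Re (dinner x y).
Proof.
have nE z : dsum_rnorm z ^+ 2 = complex.Re (dinner z z) by rewrite dinner_self.
rewrite !nE dinnerDl !dinnerDr !ReD (dinnerC y x) Re_conjc; ring.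
Qed.

Lemma cnorm_dinner_le x y : cnorm (dinner x y) <= dsum_rnorm x * dsum_rnorm y.
Proof.
rewrite -ler_sqr ?nnegrE ?mulr_ge0 ?dsum_rnorm_ge0 ?cnorm_ge0// exprMn.
rewrite mulrC psd_discriminant ?sqr_ge0// => a.
rewrite -exprMn -dsum_rnormZ -dinnerZl; have := sqr_ge0 (dsum_rnorm (y + a *: x)).
by rewrite dsum_rnormD_sqr (dinnerC y) Re_conjc addrAC.
Qed.

Definition dsum_norm x : R[i] := (dsum_rnorm x)%:C.

Lemma dsum_normD x y : dsum_norm (x + y) <= dsum_norm x + dsum_norm y.
Proof.
rewrite -rmorphD/= lecR -ler_sqr ?nnegrE ?addr_ge0 ?dsum_rnorm_ge0//.
rewrite dsum_rnormD_sqr; have := le_trans (Re_le_cnorm _) (cnorm_dinner_le x y).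
move: (complex.Re _) (dsum_rnorm x) (dsum_rnorm y) => r p q; rewrite sqrrD -mulr_natr; lra.
Qed.

Lemma dsum_normZ a x : dsum_norm (a *: x) = `|a| * dsum_norm x.
Proof. by rewrite cnormE -rmorphM/= -dsum_rnormZ. Qed.

Lemma dsum_norm0_eq0 x : dsum_norm x = 0 -> x = 0.
Proof.
move=> /complexI x0; apply: dsum_ext => i; apply: rnorm_eq0.
have [_ xb _] := dsum_rnormP x; have := xb [:: i] isT.
rewrite big_seq1 x0 expr0n/= => h; apply/eqP; rewrite -sqrf_eq0.
by rewrite eq_le h sqr_ge0.
Qed.

HB.instance Definition _ := Lmodule_isNormed.Build R[i] dsum
  dsum_normD dsum_normZ dsum_norm0_eq0.

Lemma dsum_rnormE x : rnorm x = dsum_rnorm x.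
Proof. by rewrite rnorm.unlock. Qed.

Lemma dsum_sq_bounded x : sq_bounded (dcoord x) (rnorm x ^+ 2).
Proof. by rewrite dsum_rnormE; case: (dsum_rnormP x). Qed.

Lemma dsum_rnorm_le x (c : R) : 0 <= c -> sq_bounded (dcoord x) (c ^+ 2) -> rnorm x <= c.
Proof.
move=> c0 xc; rewrite -ler_sqr ?nnegrE ?rnorm_ge0// dsum_rnormE.
by have [_ _] := dsum_rnormP x; apply.
Qed.

Lemma rnorm_dcoord x i : rnorm (dcoord x i) <= rnorm x.
Proof.
rewrite -ler_sqr ?nnegrE ?rnorm_ge0//.
by have := @dsum_sq_bounded x [:: i] isT; rewrite big_seq1.
Qed.

(** A Fatou argument: a finite sum involves finitely many coordinates, so one n serves for all of
    them, with the error e shared out as d per coordinate. *)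
Lemma sq_bounded_seq_lim (x : nat -> forall i, K i) (y : forall i, K i) (M : R) :
  (forall i, seq_lim (x^~ i) (y i)) -> (forall n, sq_bounded (x n) M) -> sq_bounded y M.
Proof.
move=> xy xM s us; apply/ler_addgt0Pr => e e0.
have [d d0 sd] : exists2 d : R, 0 < d & d * (size s)%:R <= e.
  exists (e / (size s).+1%:R); first by rewrite divr_gt0.
  by rewrite mulrAC ler_pdivrMr// ler_pM2l// ler_nat.
have near i : exists N, forall n, (N <= n)%N ->
    rnorm (y i) ^+ 2 <= rnorm (x n i) ^+ 2 + d.
  (* If p = |x_n - y| satisfies p (2 |y| + 1) < d, then |y|^2 <= |x_n|^2 + d: expand (|y| - p)^2 <=
     |x_n|^2 when p <= |y|, and use |y|^2 <= p |y| otherwise. *)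
  pose c := 2 * rnorm (y i) + 1.
  have c0 : 0 < c by rewrite ltr_wpDl// mulr_ge0 ?rnorm_ge0.
  have [N H] := xy i _ (divr_gt0 d0 c0); exists N => n /H.
  rewrite ltr_pdivlMr// /c => h; have := rnorm_distl (y i) (x n i); rewrite rnormB.
  have := rnorm_ge0 (x n i); have := rnorm_ge0 (y i); have := rnorm_ge0 (x n i - y i).
  move: h; move: (rnorm (x n i - y i)) (rnorm (y i)) (rnorm (x n i)) => p q r h p0 q0 r0 qrp.
  rewrite !expr2; have [pq|/ltW qp] := lerP p q.
    have rqp : (q - p) * (q - p) <= r * r by rewrite ler_pM ?subr_ge0// lerBlDr.
    by have := mulr_ge0 p0 p0; nra.
  by have := ler_wpM2r q0 qp; have := mulr_ge0 r0 r0; have := mulr_ge0 p0 q0; nra.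
have {near} [n Hn] : exists n, forall i, i \in s -> rnorm (y i) ^+ 2 <= rnorm (x n i) ^+ 2 + d.
  suff [N H] : exists N, forall n, (N <= n)%N -> forall i, i \in s ->
      rnorm (y i) ^+ 2 <= rnorm (x n i) ^+ 2 + d by exists N; apply: H.
  elim: s {us sd} => [|i s [N H]]; first by exists 0%N.
  have [N' H'] := near i; exists (maxn N N') => n; rewrite geq_max => /andP[Nn N'n] k.
  by rewrite inE => /orP[/eqP ->|]; [apply: H'|apply: H].
rewrite (@le_trans _ _ (\sum_(i <- s) (rnorm (x n i) ^+ 2 + d)))//.
  by rewrite big_seq [leRHS]big_seq; apply: ler_sum.
rewrite big_split/= lerD ?xM//.
by rewrite big_const_seq count_predT iter_addr_0 -mulr_natr.
Qed.

Lemma dsum_seq_complete (x : nat -> dsum) : cauchy_seq x -> exists y, seq_lim x y.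
Proof.
move=> xc.
have xic i : cauchy_seq (fun n => dcoord (x n) i).
  move=> e /xc[N H]; exists N => m n Nm Nn.
  by rewrite -dcoordB (le_lt_trans (rnorm_dcoord _ i))// H.
have [y xy] : exists y : forall i, K i, forall i, seq_lim (fun n => dcoord (x n) i) (y i).
  exists (fun i => projT1 (cid (cauchy_seq_lim (xic i)))) => i.
  exact: projT2 (cid (cauchy_seq_lim (xic i))).
have near (e : R) : 0 < e -> exists N, forall n, (N <= n)%N ->
    sq_bounded (fun i => dcoord (x n) i - y i) (e ^+ 2).
  move=> e0; have [N H] := xc _ e0; exists N => n Nn.
  apply: (@sq_bounded_seq_lim (fun k i => dcoord (x n - x (N + k)%N) i)).
    move=> i d /(xy i)[N' H']; exists N' => k Nk.
    rewrite dcoordB opprB addrC addrA subrK rnormB; apply: H'.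
    by rewrite (leq_trans Nk)// leq_addl.
  move=> k s us; rewrite (le_trans (dsum_sq_bounded _ us))//.
  by rewrite ler_sqr ?nnegrE ?rnorm_ge0 ?(ltW e0)// ltW// H// leq_addr.
have [M yM] : exists M, sq_bounded y M.
  have [N H] := near 1 ltr01; have {}H := H N (leqnn N).
  exists (2 * rnorm (x N) ^+ 2 + 2 * 1 ^+ 2) => s us.
  have hle i : rnorm (y i) ^+ 2 <=
      2 * rnorm (dcoord (x N) i) ^+ 2 + 2 * rnorm (dcoord (x N) i - y i) ^+ 2.
    by have := sq_rnormD (dcoord (x N) i) (y i - dcoord (x N) i); rewrite addrC subrK rnormB.
  rewrite (le_trans (ler_sum _ (fun i _ => hle i)))// big_split/= -!mulr_sumr.
  by rewrite lerD// ler_pM2l// ?dsum_sq_bounded ?H.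
exists (dsum_of yM) => e e0; have e2 : 0 < e / 2 by rewrite divr_gt0.
have [N H] := near _ e2; exists N => n Nn.
apply: (@le_lt_trans _ _ (e / 2)); last by rewrite ltr_pdivrMr// ltr_pMr// ltr1n.
apply: dsum_rnorm_le => [|s us]; first exact: ltW.
by under eq_bigr => i _ do rewrite dcoordB; apply: H.
Qed.

HB.instance Definition _ := Uniform_isComplete.Build dsum (seq_complete dsum_seq_complete).

Lemma dinner_bilinear : bilinear_for
  (GRing.Scale.Law.clone _ _ *%R _) (GRing.Scale.Law.clone _ _ (Num.conj \; *%R) _) dinner.
Proof.
split=> [z a x y|z a x y] /=; first exact: dinner_linear.
by rewrite dinnerDr dinnerZr.
Qed.

HB.instance Definition _ := bilinear_isBilinear.Build R[i] dsum dsum R[i]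
  *%R (Num.conj \; *%R) dinner dinner_bilinear.

Lemma dinner_hermitian x y : dinner x y = (-1) ^+ false * Num.conj (dinner y x).
Proof. by rewrite expr0 mul1r -dinnerC. Qed.

HB.instance Definition _ := isHermitianSesquilinear.Build R[i] dsum false Num.conj dinner
  dinner_hermitian.

Lemma dinner_pos x : x != 0 -> 0 < dinner x x.
Proof.
move=> x0; rewrite dinner_self (ltcR 0) exprn_gt0// lt_neqAle dsum_rnorm_ge0 andbT eq_sym.
by apply: contra x0 => /eqP n0; apply/eqP/dsum_norm0_eq0; rewrite /dsum_norm n0.
Qed.

HB.instance Definition _ := isDotProduct.Build R[i] dsum dinner dinner_pos.

Lemma dinner_norm x : (dinner : {dot dsum for Num.conj}) x x = `|x| ^+ 2.
Proof. by rewrite [LHS]dinner_self rnormE dsum_rnormE rmorphXn. Qed.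

HB.instance Definition _ := CompleteNormedModule_isHilbert.Build R dsum dinner_norm.

Lemma inner_dsum x y : inner x y = dinner x y.
Proof. by []. Qed.

End DirectSum.

(** * Representation on a direct sum *)

Section DirectSumRepresentation.
Context {R : realType} {A : cstarAlgType R} {I : eqType} (K : I -> hilbertType R).
Variable f : forall i, A -> bop (K i).
Hypothesis f_hom : forall i, star_hom (f i).
Hypothesis f_le : forall i a, rnorm (f i a) <= rnorm a.
Local Notation H := (dsum K).

Lemma rep_sq_bounded a (x : H) :
  sq_bounded (fun i => bop_fun (f i a) (dcoord x i)) ((rnorm a * rnorm x) ^+ 2).
Proof.
move=> s us; rewrite exprMn.
rewrite (@le_trans _ _ (\sum_(i <- s) rnorm a ^+ 2 * rnorm (dcoord x i) ^+ 2))//.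
  apply: ler_sum => i _; rewrite -exprMn ler_sqr ?nnegrE ?mulr_ge0 ?rnorm_ge0//.
  by rewrite (le_trans (rnorm_bop _ _))// ler_wpM2r ?rnorm_ge0.
by rewrite -mulr_sumr ler_wpM2l ?sqr_ge0// dsum_sq_bounded.
Qed.

Definition rep_fun a (x : H) : H := dsum_of (rep_sq_bounded a x).

Lemma rep_fun_bounded a : bounded_op (rep_fun a).
Proof.
apply: (@rnorm_op_bounded _ _ _ (rnorm a)) => [c x y|x].
  by apply: dsum_ext => i /=; rewrite bop_linear.
by apply: dsum_rnorm_le; [rewrite mulr_ge0 ?rnorm_ge0|apply: rep_sq_bounded].
Qed.

Definition rep a : bop H := bop_of (rep_fun_bounded a).

Lemma dcoord_rep a (x : H) i : dcoord (bop_fun (rep a) x) i = bop_fun (f i a) (dcoord x i).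
Proof. by []. Qed.

Lemma rep_star_hom : star_hom rep.
Proof.
split=> [c a b|a b|a].
- apply: bop_ext => x; apply: dsum_ext => i; have [linf _ _] := f_hom i.
  by rewrite dcoord_rep linf.
- apply: bop_ext => x; apply: dsum_ext => i; have [_ mulf _] := f_hom i.
  by rewrite dcoord_rep mulf.
- apply/esym/bop_star_unique => x y; rewrite !inner_dsum.
  apply: dinnerE; have := dinnerP x (bop_fun (rep (cstar a)) y).
  congr has_usum; apply/funext => i; have [_ _ starf] := f_hom i.
  by rewrite !dcoord_rep starf -bop_starP.
Qed.

(** The vector v in coordinate i and 0 elsewhere; as the space depends on the coordinate, v is
    transported along the equation i = k. *)
Definition dsum_single_fun i (v : K i) k : K k :=
  match pselect (i = k) with left e => ecast k (K k) e v | right _ => 0 end.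

Lemma dsum_single_eq i (v : K i) : dsum_single_fun v i = v.
Proof.
rewrite /dsum_single_fun; case: pselect => // e.
by rewrite (Prop_irrelevance e erefl).
Qed.

Lemma dsum_single_neq i (v : K i) k : i <> k -> dsum_single_fun v k = 0.
Proof. by rewrite /dsum_single_fun; case: pselect. Qed.

Lemma dsum_single_bounded i (v : K i) : sq_bounded (dsum_single_fun v) (rnorm v ^+ 2).
Proof.
move=> s us; have [si|si] := boolP (i \in s).
  rewrite (perm_big _ (perm_to_rem si))/= big_cons dsum_single_eq big1_seq ?addr0// => k.
  rewrite mem_rem_uniq// inE => /andP[_ /andP[/eqP ki _]].
  by rewrite dsum_single_neq ?rnorm0 ?expr0n// => ik; apply: ki.
rewrite big1_seq ?sqr_ge0// => k /andP[_ sk].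
rewrite dsum_single_neq ?rnorm0 ?expr0n// => ik.
by move: si; rewrite ik sk.
Qed.

(** Test the direct sum on vectors supported in the single coordinate i. *)
Lemma rnorm_rep_ge i a : rnorm (f i a) <= rnorm (rep a).
Proof.
apply: rnorm_bop_le => [|v]; first exact: rnorm_ge0.
have := rnorm_bop (rep a) (dsum_of (dsum_single_bounded v)).
have := rnorm_dcoord (bop_fun (rep a) (dsum_of (dsum_single_bounded v))) i.
rewrite dcoord_rep/= dsum_single_eq => h1 h2.
rewrite (le_trans h1)// (le_trans h2)// ler_wpM2l ?rnorm_ge0//.
by apply: dsum_rnorm_le; [exact: rnorm_ge0|exact: dsum_single_bounded].
Qed.

End DirectSumRepresentation.

(** * Contractivity of homomorphisms, and composites that fix a generating set *)

Section StarHomContractive.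
Context {R : realType}.

Lemma star_hom_linear (A B : cstarAlgType R) (f : A -> B) : star_hom f -> linear_on setT f.
Proof. by case=> linf _ _; apply: linear_setT. Qed.

Lemma rnorm_cstar_triple (A : cstarAlgType R) (x y : A) :
  rnorm (cstar_triple x x y) <= rnorm x ^+ 2 * rnorm y.
Proof.
rewrite /cstar_triple rnormZ cnormV cnorm_nat ler_pdivrMl// mulr_natl mulr2n.
rewrite (le_trans (rnormD _ _))// lerD//.
  by rewrite rnorm_cmul_le// rnorm_cmul_cstar.
rewrite -cmulA (le_trans (rnorm_cmul _ _))// rnorm_cstar_cmul.
by rewrite mulrC.
Qed.

Lemma cstar_triple_linear (A : cstarAlgType R) (x : A) : linear (cstar_triple x x).
Proof.
move=> a y z; rewrite /cstar_triple !cmulDr !cmulDl !cmulZr !cmulZl.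
rewrite addrACA -scalerDr [LHS]scalerDr; congr (_ + _).
by rewrite !scalerA mulrC.
Qed.

(** [triple_hom_bound] for D = {x, x, -} with M = |x|^2. The set S is the whole algebra for
    *-homomorphisms and the operators of a TRO for TRO-homomorphisms. *)
Lemma triple_hom_contractive (A B : cstarAlgType R) (S : set A) (f : A -> B) :
  closed S -> subspace S -> (forall x y z, S x -> S y -> S z -> S (cstar_triple x y z)) ->
  linear_on S f ->
  (forall x y z, S x -> S y -> S z ->
     f (cstar_triple x y z) = cstar_triple (f x) (f y) (f z)) ->
  forall x, S x -> rnorm (f x) <= rnorm x.
Proof.
move=> clS subS S3 linf f3 x Sx; rewrite -ler_sqr ?nnegrE ?rnorm_ge0//.
apply: (@triple_hom_bound _ _ _ S (cstar_triple x x)) => //.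
- by move=> a y z _ _; rewrite cstar_triple_linear.
- by move=> y Sy; apply: S3.
- by move=> y Sy; apply: rnorm_cstar_triple.
- exact: sqr_ge0.
- by move=> y Sy; apply: f3.
Qed.

Lemma star_hom_contractive (A B : cstarAlgType R) (f : A -> B) (x : A) :
  star_hom f -> rnorm (f x) <= rnorm x.
Proof.
move=> f_hom; apply: (@triple_hom_contractive _ _ setT) => //.
  exact: star_hom_linear.
by move=> u v w _ _ _; rewrite (star_hom_triple f_hom).2.
Qed.

Lemma star_hom_comp_id (A B : cstarAlgType R) (f : A -> B) (g : B -> A) (G : set A) :
  star_hom f -> star_hom g -> cstar_generated G = setT ->
  (forall x, G x -> g (f x) = x) -> cancel f g.
Proof.
move=> f_hom g_hom genG gfG x.
have [linf fM fS] := f_hom; have [ling gM gS] := g_hom.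
have : cstar_generated G x by rewrite genG.
move=> /(_ [set y | g (f y) = y]); apply; split; last exact: gfG.
split=> [|a y z gy gz|y z gy gz|y gy|].
- by rewrite /= (linear_on0 (subspaceT _) (linear_setT linf))
    (linear_on0 (subspaceT _) (linear_setT ling)).
- by rewrite /= linf ling gy gz.
- by rewrite /= fM gM gy gz.
- by rewrite /= fS gS gy.
apply: approx_closed => y H /=; apply/eqP; rewrite -subr_eq0; apply/eqP/rnorm_eq0/eqP.
rewrite eq_le rnorm_ge0 andbT; apply/ler_addgt0Pr => e e0; rewrite add0r ltW//.
have [z gz yz] := H _ (divr_gt0 e0 (ltr0n _ 2)).
apply: (rnorm_triangle_lt (y := z)); last by rewrite rnormB.
rewrite -{1}gz -(linear_onB (subspaceT _) (linear_setT ling))//.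
rewrite -(linear_onB (subspaceT _) (linear_setT linf))//.
by rewrite (le_lt_trans (star_hom_contractive _ g_hom))// (le_lt_trans (star_hom_contractive _ f_hom)).
Qed.

End StarHomContractive.

(** * Ternary rings of operators *)

Section TernaryRings.
Context {R : realType}.

Section OneSpace.
Context {H : hilbertType R}.
Implicit Types (T : set (H -> H)) (f g : bop H).

Definition bop_set T : set (bop H) := [set f | T (bop_fun f)].

Lemma op_closedP T : T `<=` @bounded_op R H H -> op_closed T <-> closed (bop_set T).
Proof.
move=> Tb; split=> [Tcl|Tcl f fb fT].
  apply: approx_closed => f fT; apply: Tcl; first exact: bop_bounded.
  move=> _ /gt0_complex[e e0 ->]; have [g Tg fg] := fT _ e0.
  exists (bop_fun g) => // u; rewrite -bopB !rnormE -rmorphM lecR.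
  by rewrite (le_trans (rnorm_bop _ _))// ler_wpM2r ?rnorm_ge0 ?ltW.
apply: (@closed_approx _ _ (bop_set T) (bop_of fb)) => // e e0.
have e2 : 0 < (e / 2)%:C :> R[i] by rewrite (ltcR 0) divr_gt0.
have [g Tg fg] := fT _ e2.
exists (bop_of (Tb _ Tg)) => //.
apply: (@le_lt_trans _ _ (e / 2)); last by rewrite ltr_pdivrMr// ltr_pMr// ltr1n.
apply: rnorm_bop_le => [|u]; first by rewrite divr_ge0 ?ltW.
by rewrite bopB; have := fg u; rewrite !rnormE -rmorphM lecR.
Qed.

Lemma tro_ofP (S : set (bop H)) : closed S -> subspace S ->
  (forall f g h, S f -> S g -> S h -> S (cmul (cmul f (cstar g)) h)) ->
  is_tro [set t | exists2 f, S f & t = bop_fun f].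
Proof.
move=> Scl [S0 Slin] S3; set T := [set t | _].
have Tb : T `<=` @bounded_op R H H by move=> _ [f _ ->]; apply: bop_bounded.
have TE f : T (bop_fun f) <-> S f.
  split=> [[g Sg fg]|Sf]; last by exists f.
  by rewrite (_ : f = g)//; apply: bop_ext => x; rewrite fg.
split=> //.
- by exists 0.
- move=> a _ _ [f Sf ->] [g Sg ->]; exists (a *: f + g) => //; exact: Slin.
- move=> _ _ _ [f Sf ->] [g Sg ->] [h Sh ->].
  by exists (cmul (cmul f (cstar g)) h) => //; apply: S3.
apply/op_closedP => //; rewrite (_ : bop_set T = S)//.
by apply/seteqP; split=> f /TE.
Qed.

Section BopSet.
Context (T : set (H -> H)).
Hypothesis troT : is_tro T.

Lemma bop_set_closed : closed (bop_set T).
Proof. by have [Tb _ _ _ Tcl] := troT; apply/op_closedP. Qed.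

Lemma bop_set_subspace : subspace (bop_set T).
Proof.
have [_ T0 Tlin _ _] := troT; split; first exact: T0.
by move=> a f g Tf Tg; apply: Tlin.
Qed.

Lemma bop_set_ternary f g h : bop_set T f -> bop_set T g -> bop_set T h ->
  bop_set T (cmul (cmul f (cstar g)) h).
Proof. by have [_ _ _ T3 _] := troT => Tf Tg Th; apply: T3. Qed.

Lemma bop_set_triple f g h : bop_set T f -> bop_set T g -> bop_set T h ->
  bop_set T (cstar_triple f g h).
Proof.
move=> Tf Tg Th; apply/(subspaceZ bop_set_subspace)/(subspaceD bop_set_subspace);
  exact: bop_set_ternary.
Qed.

Lemma tro_bounded t : T t -> exists f : bop H, t = bop_fun f.
Proof. by have [Tb _ _ _ _] := troT => /Tb tb; exists (bop_of tb). Qed.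

End BopSet.

(** An ambient TRO containing G is required: if there were none, the intersection defining
    [tro_generated G] would be empty and yield all functions, unbounded ones included. *)
Lemma tro_generated_tro (G : set (H -> H)) (T : set (H -> H)) :
  is_tro T -> G `<=` T -> is_tro (tro_generated G).
Proof.
move=> troT GT; split.
- move=> t Gt; have [Tb _ _ _ _] := troT; apply: Tb; exact: Gt.
- by move=> S [[]].
- move=> a x y Gx Gy S [troS GS]; have [_ _ Slin _ _] := troS.
  by apply: Slin; [apply: Gx|apply: Gy].
- move=> x y z Gx Gy Gz S [troS GS]; have [_ _ _ S3 _] := troS.
  by apply: S3; [apply: Gx|apply: Gy|apply: Gz].
- move=> f fb fG S [troS GS]; have [_ _ _ _ Scl] := troS.
  by apply: Scl => // e /fG[g Gg fg]; exists g => //; apply: Gg.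
Qed.

Lemma tro_generated_sub (G : set (H -> H)) : G `<=` tro_generated G.
Proof. by move=> t Gt S [_]; apply. Qed.

Lemma tro_generated_min (G T : set (H -> H)) :
  is_tro T -> G `<=` T -> tro_generated G `<=` T.
Proof. by move=> troT GT t; apply. Qed.

End OneSpace.

(* The junk value 0 is only taken at operators outside [T1]. *)
Definition bop_lift (H1 H2 : hilbertType R) (T1 : set (H1 -> H1)) (T2 : set (H2 -> H2))
    (F : (H1 -> H1) -> (H2 -> H2)) (f : bop H1) : bop H2 :=
  xget 0 [set g | T1 (bop_fun f) /\ bop_fun g = F (bop_fun f)].

Section Hom.
Context {H1 H2 : hilbertType R} {T1 : set (H1 -> H1)} {T2 : set (H2 -> H2)}.
Context {F : (H1 -> H1) -> (H2 -> H2)}.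
Hypotheses (tro1 : is_tro T1) (tro2 : is_tro T2) (F_hom : tro_hom T1 T2 F).
Local Notation phi := (bop_lift T1 T2 F).

Lemma bop_liftE f : bop_set T1 f -> bop_fun (phi f) = F (bop_fun f).
Proof.
move=> Tf; have [F12 _ _] := F_hom; have [g Fg] := tro_bounded tro2 (F12 _ Tf).
by rewrite /bop_lift; case: xgetP => [h _ []//|/(_ g)[]].
Qed.

Lemma bop_lift_set f : bop_set T1 f -> bop_set T2 (phi f).
Proof. by move=> Tf; rewrite /bop_set/= bop_liftE//; have [F12 _ _] := F_hom; apply: F12. Qed.

Lemma bop_lift_linear : linear_on (bop_set T1) phi.
Proof.
move=> a f g Tf Tg; have [_ Flin _] := F_hom.
have Tfg : bop_set T1 (a *: f + g) by apply: (bop_set_subspace tro1).2.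
apply: bop_ext => x; rewrite bopD bopZ !bop_liftE//.
by have := congr1 (fun k => k x) (Flin a _ _ Tf Tg).
Qed.

Lemma bop_lift_ternary f g h : bop_set T1 f -> bop_set T1 g -> bop_set T1 h ->
  phi (cmul (cmul f (cstar g)) h) = cmul (cmul (phi f) (cstar (phi g))) (phi h).
Proof.
move=> Tf Tg Th; have [_ _ F3] := F_hom; apply: bop_ext => x.
rewrite bop_ternary !bop_liftE//; last exact: bop_set_ternary.
by rewrite -F3.
Qed.

Lemma bop_lift_contractive f : bop_set T1 f -> rnorm (phi f) <= rnorm f.
Proof.
apply: (@triple_hom_contractive _ _ _ (bop_set T1)) f.
- exact: bop_set_closed.
- exact: bop_set_subspace.
- exact: bop_set_triple.
- exact: bop_lift_linear.
move=> f g h Tf Tg Th; rewrite /cstar_triple.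
have S1 := bop_set_ternary tro1 Tf Tg Th; have S2 := bop_set_ternary tro1 Th Tg Tf.
rewrite (linear_onZ (bop_set_subspace tro1) bop_lift_linear); last first.
  exact: (subspaceD (bop_set_subspace tro1)).
by rewrite (linear_onD bop_lift_linear)// !bop_lift_ternary.
Qed.

End Hom.

(** The fixed points are collected inside [bop H1], where contractivity makes them a closed set, and
    are then turned back into a TRO of functions to be compared with the generated one. *)
Lemma tro_hom_comp_id (H1 H2 : hilbertType R) (T1 : set (H1 -> H1)) (T2 : set (H2 -> H2))
    (F : (H1 -> H1) -> (H2 -> H2)) (G : (H2 -> H2) -> (H1 -> H1)) (X : set (H1 -> H1)) :
  is_tro T1 -> is_tro T2 -> tro_hom T1 T2 F -> tro_hom T2 T1 G ->
  tro_generated X = T1 -> (forall t, X t -> G (F t) = t) ->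
  forall t, T1 t -> G (F t) = t.
Proof.
move=> tro1 tro2 F_hom G_hom genX GFX t T1t.
pose phi := bop_lift T1 T2 F; pose psi := bop_lift T2 T1 G.
pose S := [set f | bop_set T1 f /\ psi (phi f) = f].
have sub1 := bop_set_subspace tro1; have sub2 := bop_set_subspace tro2.
have linF : linear_on (bop_set T1) phi := bop_lift_linear tro1 tro2 F_hom.
have linG : linear_on (bop_set T2) psi := bop_lift_linear tro2 tro1 G_hom.
have Fset f : bop_set T1 f -> bop_set T2 (phi f) := bop_lift_set tro2 F_hom (f := f).
have troS : is_tro [set s | exists2 f, S f & s = bop_fun f].
  apply: tro_ofP.
  (* Membership in T1 is settled first, since [phi] is known to be linear and contractive only
     there. *)
  - apply: approx_closed => f fS.
    have Tf : bop_set T1 f.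
      apply: closed_approx => [|e /fS[g [Tg _] fg]]; first exact: bop_set_closed.
      by exists g.
    split=> //; apply/eqP; rewrite -subr_eq0; apply/eqP/rnorm_eq0/eqP.
    rewrite eq_le rnorm_ge0 andbT; apply/ler_addgt0Pr => e e0; rewrite add0r ltW//.
    have [g [Tg gg] fg] := fS _ (divr_gt0 e0 (ltr0n _ 2)).
    apply: (rnorm_triangle_lt (y := g)); last by rewrite rnormB.
    have Tfg := subspaceB sub1 Tf Tg; have Ff := Fset _ Tf; have Fg := Fset _ Tg.
    rewrite -{1}gg -(linear_onB sub2 linG)// -(linear_onB sub1 linF)//.
    rewrite (le_lt_trans (bop_lift_contractive tro2 tro1 G_hom (Fset _ Tfg)))//.
    by rewrite (le_lt_trans (bop_lift_contractive tro1 tro2 F_hom Tfg)).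
  - split=> [|a f g [Tf ff] [Tg gg]]; first split; first by case: sub1.
      by rewrite (linear_on0 sub1 linF) (linear_on0 sub2 linG).
    split; first exact: sub1.2.
    by rewrite linF// linG ?ff ?gg//; apply: Fset.
  - move=> f g h [Tf ff] [Tg gg] [Th hh]; split; first exact: bop_set_ternary.
    have Ff := Fset _ Tf; have Fg := Fset _ Tg; have Fh := Fset _ Th.
    rewrite /phi (bop_lift_ternary tro1 tro2 F_hom)// /psi.
    by rewrite (bop_lift_ternary tro2 tro1 G_hom)// -/phi -/psi ff gg hh.
have : tro_generated X t by rewrite genX.
move=> /(tro_generated_min troS)[|f [Tf ff] ->].
  move=> s Xs; have T1s : T1 s by rewrite -genX; apply: tro_generated_sub.
  have [f sf] := tro_bounded tro1 T1s; have Tf : bop_set T1 f by rewrite /bop_set/= -sf.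
  exists f => //; split=> //; apply: bop_ext => x; have Ff := Fset _ Tf.
  rewrite /psi (bop_liftE tro1 G_hom)// /phi (bop_liftE tro2 F_hom)//.
  by rewrite -sf GFX.
by rewrite -(bop_liftE tro2 F_hom Tf) -(bop_liftE tro1 G_hom (Fset _ Tf)) -/phi -/psi ff.
Qed.

End TernaryRings.

(** * Existence of the universal C*-algebra and of the universal TRO *)

Section Universal.
Context {R : realType} (Z : jbTripleType R).

Definition cstar_family : triple_family Z := @TripleFamily R Z
  {B : cstarAlgType R & {phi : Z -> B | triple_hom (@box R Z) (@cstar_triple R B) phi}}
  (fun j => projT1 j) (fun j => proj1_sig (projT2 j)) (fun j => proj2_sig (projT2 j)).

Lemma universal_cstar_exists : universal_cstar (univ_map cstar_family).
Proof.
split; [exact: univ_map_hom| |exact: univ_generated].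
move=> B phi phi_hom.
pose j : tf_idx cstar_family := existT _ B (exist _ phi phi_hom).
exists (@univ_ev R Z cstar_family j); first exact: (@univ_ev_star_hom R Z cstar_family j).
by apply/funext => z; exact: (@univ_ev_map R Z cstar_family j z).
Qed.

(** With targets B(K) only, the resulting algebra comes with enough representations on Hilbert
    spaces, and no Gelfand-Naimark theorem is invoked. *)
Definition operator_family : triple_family Z := @TripleFamily R Z
  {K : hilbertType R &
    {phi : Z -> bop K | triple_hom (@box R Z) (@cstar_triple R (bop K)) phi}}
  (fun j => bop (projT1 j)) (fun j => proj1_sig (projT2 j)) (fun j => proj2_sig (projT2 j)).

Local Notation A := (univ_alg operator_family).
Local Notation J := (tf_idx operator_family).
Local Notation ev := (@univ_ev R Z operator_family).

(* All Hilbert spaces together form too large an index for a direct sum, but the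
   seminorms they induce on [A] form a small one, and one representation for each
   seminorm is enough for the direct sum to be isometric. *)
Definition ev_seminorm : Type :=
  {p : A -> R | exists j : J, p = fun a => rnorm (ev j a)}.

HB.instance Definition _ := gen_eqMixin ev_seminorm.

Definition ev_repr (p : ev_seminorm) : J := projT1 (cid (proj2_sig p)).

Definition univ_space (p : ev_seminorm) : hilbertType R := projT1 (ev_repr p).

Definition univ_rep_at (p : ev_seminorm) : A -> bop (univ_space p) := ev (ev_repr p).

Lemma univ_rep_at_hom p : star_hom (@univ_rep_at p).
Proof. exact: (@univ_ev_star_hom R Z operator_family (ev_repr p)). Qed.

Lemma univ_rep_at_le p a : rnorm (univ_rep_at p a) <= rnorm a.
Proof. exact: (@rnorm_univ_ev R Z operator_family (ev_repr p)). Qed.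

Definition univ_rep : A -> bop (dsum univ_space) := rep univ_rep_at_le.

Lemma univ_rep_hom : star_hom univ_rep.
Proof. exact: rep_star_hom univ_rep_at_hom univ_rep_at_le. Qed.

Lemma univ_rep_linear : linear_on setT univ_rep.
Proof. exact: star_hom_linear univ_rep_hom. Qed.

Lemma rnorm_univ_rep a : rnorm (univ_rep a) = rnorm a.
Proof.
apply/eqP; rewrite eq_le (star_hom_contractive _ univ_rep_hom)/=.
apply: univ_rnorm_le => [|j]; first exact: rnorm_ge0.
pose p : ev_seminorm := exist _ (fun a => rnorm (ev j a)) (ex_intro _ j erefl).
(* The representative chosen for p may differ from j, but it induces the same seminorm. *)
have pE : (fun a => rnorm (ev j a)) = fun a => rnorm (ev (ev_repr p) a).
  exact: projT2 (cid (proj2_sig p)).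
rewrite (congr1 (fun q => q a) pE).
exact: (rnorm_rep_ge univ_rep_at_le p a).
Qed.

Lemma univ_rep_inj : injective univ_rep.
Proof.
move=> a b ab; apply/eqP; rewrite -subr_eq0; apply/eqP/rnorm_eq0.
by rewrite -rnorm_univ_rep (linear_onB (subspaceT _) univ_rep_linear)// ab subrr rnorm0.
Qed.

(** Closedness passes to the image because [univ_rep] is isometric: preimages of a convergent
    sequence are Cauchy and converge in S. *)
Lemma univ_rep_image_tro (S : set A) : closed S -> subspace S ->
  (forall a b c, S a -> S b -> S c -> S (cmul (cmul a (cstar b)) c)) ->
  is_tro [set t | exists2 f, (univ_rep @` S) f & t = bop_fun f].
Proof.
move=> Scl [S0 Slin] S3; have [replin repM repS] := univ_rep_hom.
apply: tro_ofP.
- apply: approx_closed => f fS.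
  have e0 n : 0 < (n.+1%:R^-1 : R) by rewrite invr_gt0.
  have /choice[a aP] n : exists a, S a /\ rnorm (f - univ_rep a) < n.+1%:R^-1.
    by have [_ [a Sa <-] fa] := fS _ (e0 n); exists a.
  have ac : cauchy_seq a.
    move=> e ep; have [N HN] := eventually_invS_lt (divr_gt0 ep (ltr0n _ 2)).
    exists N => m n /HN hm /HN hn.
    rewrite -rnorm_univ_rep (linear_onB (subspaceT _) univ_rep_linear)//.
    apply: (rnorm_triangle_lt (y := f)).
      by rewrite rnormB (lt_trans (aP m).2).
    by rewrite (lt_trans (aP n).2).
  have [b ab] := cauchy_seq_lim ac.
  exists b.
    apply: closed_approx => // e /ab[N /(_ _ (leqnn N)) H].
    by exists (a N); [exact: (aP N).1|rewrite rnormB].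
  apply/esym/(@seq_lim_uniq _ _ (fun n => univ_rep (a n))).
    move=> e ep; have [N HN] := eventually_invS_lt ep; exists N => n /HN hn.
    by rewrite rnormB (lt_trans (aP n).2).
  move=> e /ab[N H]; exists N => n /H.
  by rewrite -rnorm_univ_rep (linear_onB (subspaceT _) univ_rep_linear).
- split=> [|c _ _ [a Sa <-] [b Sb <-]].
    by exists 0 => //; rewrite (linear_on0 (subspaceT _) univ_rep_linear).
  by exists (c *: a + b); [exact: Slin|rewrite replin].
- move=> _ _ _ [a Sa <-] [b Sb <-] [c Sc <-].
  by exists (cmul (cmul a (cstar b)) c); [exact: S3|rewrite !repM repS].
Qed.

Definition univ_tro_map (z : Z) : dsum univ_space -> dsum univ_space :=
  bop_fun (univ_rep (univ_map operator_family z)).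

Lemma universal_tro_exists :
  universal_tro (tro_generated (range univ_tro_map)) univ_tro_map.
Proof.
(* The full image is a TRO around the generators; hence every operator of the generated TRO has the
   form [univ_rep a]. *)
have image_tro : is_tro [set t | exists2 f, (univ_rep @` setT) f & t = bop_fun f].
  exact: univ_rep_image_tro.
have gen_sub : tro_generated (range univ_tro_map) `<=`
    [set t | exists2 f, (univ_rep @` setT) f & t = bop_fun f].
  apply: tro_generated_min => // _ [z _ <-].
  by exists (univ_rep (univ_map operator_family z)) => //; exists (univ_map operator_family z).
split=> //.
- apply: tro_generated_tro image_tro _ => _ [z _ <-].
  by exists (univ_rep (univ_map operator_family z)) => //; exists (univ_map operator_family z).
- split; last by move=> z; apply: tro_generated_sub; exists z.
  have [replin rep3] := star_hom_triple univ_rep_hom.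
  have [maplin map3] := univ_map_hom operator_family.
  split=> [a x y|x y z]; rewrite /univ_tro_map.
    by rewrite maplin replin.
  by rewrite map3 rep3 bop_triple.
move=> K S alpha troS [[alphalin alpha3] alphaS].
have [Sb _ _ _ _] := troS.
(* Viewed in the C*-algebra B(K), alpha is one of the indices of [operator_family]; that its
   extension takes values in S is a separate matter, settled by [SA] below. *)
pose alphaB z : bop K := bop_of (Sb _ (alphaS z)).
have alphaB_hom : triple_hom (@box R Z) (@cstar_triple R (bop K)) alphaB.
  split=> [a x y|x y z]; apply: bop_ext => u.
    by have := congr1 (fun k => k u) (alphalin a x y).
  by have := congr1 (fun k => k u) (alpha3 x y z).
pose j : J := existT _ K (exist _ alphaB alphaB_hom).
pose f : A -> bop K := ev j.
have f_hom : star_hom f := @univ_ev_star_hom R Z operator_family j.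
have [flin fM fS] := f_hom.
(* F is f after the inverse of the injective [univ_rep]; the default 0 concerns only operators
   outside the image. *)
pose F t : K -> K := bop_fun (f (xget 0 [set a | bop_fun (univ_rep a) = t])).
have FE a : F (bop_fun (univ_rep a)) = bop_fun (f a).
  rewrite /F; case: xgetP => [b _ ba|/(_ a)/(_ erefl)//]; suff -> : b = a by [].
  by apply: univ_rep_inj; apply: bop_ext => x; exact: (congr1 (fun k => k x) ba).
have fmap z : bop_fun (f (univ_map operator_family z)) = alpha z.
  have -> : f (univ_map operator_family z) = alphaB z :=
    @univ_ev_map R Z operator_family j z.
  by [].
have genE t : tro_generated (range univ_tro_map) t -> exists a, t = bop_fun (univ_rep a).
  by move=> /gen_sub[_ [a _ <-] ->]; exists a.
exists F; last by apply/funext => z; rewrite /= /univ_tro_map FE fmap.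
split.
(* The preimage of S under f is closed and ternary, so its image under [univ_rep] is a TRO
   containing the generators, and F sends it into S. *)
- pose SA := [set a | S (bop_fun (f a))].
  have troSA : is_tro [set t | exists2 f, (univ_rep @` SA) f & t = bop_fun f].
    apply: univ_rep_image_tro.
    + apply: approx_closed => a aS.
      apply: (closed_approx (bop_set_closed troS)) => e /aS[b Sb' ab].
      exists (f b) => //.
      rewrite -(linear_onB (subspaceT _) (linear_setT flin))//.
      by rewrite (le_lt_trans (star_hom_contractive _ f_hom)).
    + split.
        rewrite /SA/= (linear_on0 (subspaceT _) (linear_setT flin)).
        exact: (bop_set_subspace troS).1.
      move=> c a b Sa Sb'; rewrite /SA/= flin.
      exact: ((bop_set_subspace troS).2 c (f a) (f b)).
    + move=> a b c Sa Sb' Sc; rewrite /SA/= !fM fS.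
      exact: (bop_set_ternary troS (f := f a) (g := f b) (h := f c)).
  have genSA : range univ_tro_map `<=`
      [set t | exists2 f, (univ_rep @` SA) f & t = bop_fun f].
    move=> _ [z _ <-]; exists (univ_rep (univ_map operator_family z)) => //.
    by exists (univ_map operator_family z) => //; rewrite /SA/= fmap.
  move=> t /(tro_generated_min troSA genSA)[_ [a Sa <-] ->].
  by rewrite FE.
- move=> c x y /genE[a ->] /genE[b ->].
  have [replin _ _] := univ_rep_hom.
  by rewrite -[_ *: _ + _]/(bop_fun (c *: univ_rep a + univ_rep b)) -replin !FE flin.
move=> x y z /genE[a ->] /genE[b ->] /genE[c ->].
have [_ repM repS] := univ_rep_hom.
by rewrite -[X in F X]bop_ternary -repS -!repM !FE !fM fS.
Qed.

End Universal.

Theorem theorem2p2 (R : realType) (Z : jbTripleType R) :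
  ((exists (A : cstarAlgType R) (psi : Z -> A), universal_cstar psi) /\
   (forall (A1 A2 : cstarAlgType R) (psi1 : Z -> A1) (psi2 : Z -> A2),
      universal_cstar psi1 -> universal_cstar psi2 ->
      exists2 theta : A1 -> A2, star_iso theta & theta \o psi1 = psi2))
  /\
  ((exists (H : hilbertType R) (T : set (H -> H)) (rho : Z -> H -> H),
      universal_tro T rho) /\
   (forall (H1 H2 : hilbertType R) (T1 : set (H1 -> H1)) (T2 : set (H2 -> H2))
      (rho1 : Z -> H1 -> H1) (rho2 : Z -> H2 -> H2),
      universal_tro T1 rho1 -> universal_tro T2 rho2 ->
      exists2 theta : (H1 -> H1) -> (H2 -> H2),
        tro_iso T1 T2 theta & theta \o rho1 = rho2)).
Proof.
split; split.
- exists (univ_alg (cstar_family Z) : cstarAlgType R), (univ_map (cstar_family Z)).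
  exact: universal_cstar_exists.
- move=> A1 A2 psi1 psi2 [hom1 univ1 gen1] [hom2 univ2 gen2].
  (* Each universal property supplies a map to the other object; both composites fix the generators,
     hence everything. *)
  have [f f_hom f1] := univ1 _ _ hom2; have [g g_hom g2] := univ2 _ _ hom1.
  exists f => //; split=> //; exists g.
    apply: star_hom_comp_id f_hom g_hom gen1 _ => _ [z _ <-].
    by rewrite -[f _]/((f \o psi1) z) f1 -[LHS]/((g \o psi2) z) g2.
  apply: star_hom_comp_id g_hom f_hom gen2 _ => _ [z _ <-].
  by rewrite -[g _]/((g \o psi2) z) g2 -[LHS]/((f \o psi1) z) f1.
- exists (dsum (@univ_space R Z) : hilbertType R), (tro_generated (range (@univ_tro_map R Z))),
    (@univ_tro_map R Z).
  exact: universal_tro_exists.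
move=> H1 H2 T1 T2 rho1 rho2 [tro1 [hom1 in1] univ1 gen1] [tro2 [hom2 in2] univ2 gen2].
have [f f_hom f1] := univ1 _ _ _ tro2 (conj hom2 in2).
have [g g_hom g2] := univ2 _ _ _ tro1 (conj hom1 in1).
have gf t : T1 t -> g (f t) = t.
  apply: (tro_hom_comp_id tro1 tro2 f_hom g_hom gen1) => _ [z _ <-].
  by rewrite -[f _]/((f \o rho1) z) f1 -[LHS]/((g \o rho2) z) g2.
have fg t : T2 t -> f (g t) = t.
  apply: (tro_hom_comp_id tro2 tro1 g_hom f_hom gen2) => _ [z _ <-].
  by rewrite -[g _]/((g \o rho2) z) g2 -[LHS]/((f \o rho1) z) f1.
exists f => //; split=> //; split.
- by case: f_hom.
- by move=> s t /set_mem T1s /set_mem T1t st; rewrite -(gf _ T1s) st gf.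
- by move=> t T2t; exists (g t); [have [g21 _ _] := g_hom; apply: g21|apply: fg].
Qed.
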